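(* There exist an integer $n\ge 2$ and a global solution $u$ to the thin obstacle problem in $\mathbb{R}^{n+1}$ satisfying the polynomial growth condition $\left\|\frac{u(x)}{1+|x|^m}\right\|_{L^\infty(\mathbb{R}^{n+1})}<+\infty$ with $m=4$, whose contact set $\Lambda(u)$ is compact, nonconvex, and star-shaped.
   Context: Write $x=(x',x_{n+1})\in\mathbb{R}^n\times\mathbb{R}$. A global solution to the thin obstacle problem in $\mathbb{R}^{n+1}$ is a continuous function $u:\mathbb{R}^{n+1}\to\mathbb{R}$ such that: $u\ge 0$ on $\{x_{n+1}=0\}$; $\Delta u=0$ in $\mathbb{R}^{n+1}\setminus\{x_{n+1}=0,\ u=0\}$; $\Delta u\le 0$ in $\mathbb{R}^{n+1}$ (in the weak, i.e. distributional or viscosity, sense); and $u(x',x_{n+1})=u(x',-x_{n+1})$ in $\mathbb{R}^{n+1}$. Its contact set is $\Lambda(u)=\{(x',0): x'\in\mathbb{R}^n,\ u(x',0)=0\}$. *)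

(* Defs.v *)
From HB Require Import structures.
From mathcomp Require Import all_boot all_order all_algebra.
From mathcomp Require Import all_classical all_reals all_analysis.

Set Implicit Arguments.
Unset Strict Implicit.
Unset Printing Implicit Defensive.

Import Order.TTheory GRing.Theory Num.Theory.
Import numFieldNormedType.Exports.

Local Open Scope classical_set_scope.
Local Open Scope ring_scope.

(* Points of R^{n+1} are row vectors ['rV[R]_n.+1]; the entry at [ord_max] is
   the coordinate x_{n+1}, the other entries form x'. *)

(* The norm MathComp-Analysis puts on row vectors is the max-norm. *)
Definition euclid_norm (R : realType) (n : nat) (x : 'rV[R]_n) : R :=
  Num.sqrt (\sum_(i < n) x 0 i ^+ 2).

Definition partial (R : realType) (n : nat) (i : 'I_n) (f : 'rV[R]_n -> R)
    (x : 'rV[R]_n) : R :=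
  'D_(delta_mx 0 i) f x.

Definition laplacian (R : realType) (n : nat) (f : 'rV[R]_n -> R)
    (x : 'rV[R]_n) : R :=
  \sum_(i < n) partial i (partial i f) x.

(* [f] is of class C^2 on [A]; meant for [A] open. The existence of partial
   derivatives is required explicitly, because ['D_v] is a total operator. *)
Definition C2_on (R : realType) (n : nat) (A : set 'rV[R]_n)
    (f : 'rV[R]_n -> R) : Prop :=
  forall x, A x ->
    [/\ {for x, continuous f},
        forall i, derivable f x (delta_mx 0 i) /\
                  {for x, continuous (partial i f)} &
        forall i j, derivable (partial i f) x (delta_mx 0 j) /\
                    {for x, continuous (partial j (partial i f))}].

Definition harmonic_on (R : realType) (n : nat) (A : set 'rV[R]_n)
    (u : 'rV[R]_n -> R) : Prop :=
  C2_on A u /\ forall x, A x -> laplacian u x = 0.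

(* The inequality [laplacian u <= 0] on the whole space in the viscosity
   sense: every C^2 function touching [u] from below at [x0] has nonpositive
   Laplacian at [x0]. *)
Definition viscosity_superharmonic (R : realType) (n : nat)
    (u : 'rV[R]_n -> R) : Prop :=
  forall (phi : 'rV[R]_n -> R) (x0 : 'rV[R]_n),
    C2_on setT phi ->
    phi x0 = u x0 ->
    (\forall x \near x0, phi x <= u x) ->
    laplacian phi x0 <= 0.

Definition thin_reflection (R : realType) (n : nat) (x : 'rV[R]_n.+1) :
    'rV[R]_n.+1 :=
  \row_(i < n.+1) (if i == ord_max then - x 0 i else x 0 i).

Definition contact_set (R : realType) (n : nat) (u : 'rV[R]_n.+1 -> R) :
    set 'rV[R]_n.+1 :=
  [set x : 'rV[R]_n.+1 | x 0 ord_max = 0 /\ u x = 0].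

Record thin_obstacle_solution (R : realType) (n : nat)
    (u : 'rV[R]_n.+1 -> R) : Prop := ThinObstacleSolution {
  thin_obstacle_continuous : continuous u;
  thin_obstacle_ge0 : forall x : 'rV[R]_n.+1, x 0 ord_max = 0 -> 0 <= u x;
  thin_obstacle_harmonic : harmonic_on (~` contact_set u) u;
  thin_obstacle_superharmonic : viscosity_superharmonic u;
  thin_obstacle_even : forall x, u (thin_reflection x) = u x
}.

(* The library has no Lebesgue measure on row vectors, so Lebesgue-null sets
   are given by coverings with countably many closed boxes. *)
Definition box (R : realType) (n : nat) (a b : 'rV[R]_n) : set 'rV[R]_n :=
  [set x : 'rV[R]_n | forall i, a 0 i <= x 0 i <= b 0 i].

Definition box_volume (R : realType) (n : nat) (a b : 'rV[R]_n) : R :=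
  \prod_(i < n) Num.max 0 (b 0 i - a 0 i).

Definition lebesgue_null (R : realType) (n : nat) (N : set 'rV[R]_n) : Prop :=
  forall e : R, 0 < e ->
    exists a b : nat -> 'rV[R]_n,
      N `<=` \bigcup_k box (a k) (b k) /\
      (\sum_(0 <= k <oo) (box_volume (a k) (b k))%:E <= e%:E)%E.

(* Essential supremum of [`|f|], as in [ess_sup]. *)
Definition Linfty_norm (R : realType) (n : nat) (f : 'rV[R]_n -> R) : \bar R :=
  ereal_inf [set y : \bar R |
    lebesgue_null [set x | ~ (`|f x|%:E <= y)%E]].

Definition polynomial_growth (R : realType) (n m : nat) (u : 'rV[R]_n -> R) :
    Prop :=
  (Linfty_norm (fun x => u x / (1 + euclid_norm x ^+ m))%R < +oo)%E.

Definition star_shaped (R : realType) (n : nat) (A : set 'rV[R]_n) : Prop :=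
  exists2 c, A c &
    forall x, A x -> forall t : R, 0 <= t <= 1 -> A ((1 - t) *: c + t *: x).

(* Main.v *)
(** The solution is [u = p + w] with [n = 4]: [p] is the harmonic extension of
[P - 1], where [P] is a quartic form on the thin space whose sublevel set
[P <= 1] has long spikes along the axes, and [w] is the least nonnegative
superharmonic function lying above [1 - P] on the thin space.

Star-shapedness: for [t < 1] the rescaling [t ^ -4 w (t x)] solves the problem
with obstacle [t ^ -4 - P], a vertical translate of [1 - P], so it is at most
[w + t ^ -4 - 1]; at a contact point [x] this forces contact at [t x].
Nonconvexity: the contact set lies in [P <= 1]; if it were convex, its
symmetries would bound it independently of the length of the spikes, so [w] would decay
like the Newtonian potential of a fixed ball, and [P - 1 + w] would be negative
far out on an axis, where [P] is still small.

[w] is the limit, along an ultrafilter of steps [h -> 0], of the least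
supersolutions [w_h] of the same problem for the finite-difference Laplacian of
step [h], taken on functions on the whole space and with the obstacle extended
by a wedge [1 - P - K |z|]. Perron's method for [w_h] is elementary, translation
gives a uniform Lipschitz bound, and tangential semiconvexity excludes contact
away from the thin space. Discrete harmonic functions satisfy interior gradient
bounds by comparison of an odd reflection with a quadratic barrier; iterating
them three times makes the limit of class [C^2] and harmonic off the contact
set. *)

Require Import Defs.
From HB Require Import structures.
From mathcomp Require Import all_boot all_order all_algebra.
From mathcomp Require Import all_classical all_reals all_analysis.
From mathcomp Require Import perm.
From mathcomp Require Import ring lra.

Set Implicit Arguments.
Unset Strict Implicit.
Unset Printing Implicit Defensive.

Import Order.TTheory GRing.Theory Num.Theory.
Import numFieldNormedType.Exports.

Local Open Scope classical_set_scope.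
Local Open Scope ring_scope.

Local Notation "''e_' i" := (delta_mx 0 i) (at level 8, i at level 2).

(** * Discrete superharmonic functions *)

(** The operator of step [h] couples only points of one translate of the grid of mesh [h], and most
    translates miss the thin space. An obstacle living on that space alone would leave them
    unconstrained and make the least supersolution discontinuous; the wedge makes the obstacle
    visible to every translate. Working on the whole space rather than on one grid allows
    translation by arbitrary vectors. The price is that discrete maximum principles cannot rely on
    continuity, so suprema are only approached.

    Most properties of [w_h] come from one device: exhibit a competitor that is again a
    supersolution and invoke minimality. After the passage to the limit, comparison with limits of
    discrete superharmonic functions takes over that role.

    Ambient dimension 5 suits the inverse quadratic [(16 + |x|^2)^-1]: there its superharmonicity
    has a margin that absorbs the discretization error. Degree 4 of [P] gives both the growth rate
    and the homogeneity used under dilation. *)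

Definition dlap (R : realType) (d : nat) (h : R) (f : 'rV[R]_d -> R)
    (x : 'rV[R]_d) : R :=
  \sum_(i < d) (f (x + h *: 'e_i) + f (x - h *: 'e_i) - 2 * f x).

Definition supersol (R : realType) (d : nat) (h : R) (Psi : 'rV[R]_d -> R)
    (v : 'rV[R]_d -> R) : Prop :=
  [/\ forall x, 0 <= v x, forall x, Psi x <= v x & forall x, dlap h v x <= 0].

Definition least_supersol (R : realType) (d : nat) (h : R)
    (Psi : 'rV[R]_d -> R) (x : 'rV[R]_d) : R :=
  inf [set v x | v in supersol h Psi].

Lemma dlap_cst (R : realType) (d : nat) (h c : R) (x : 'rV[R]_d) :
  dlap h (fun=> c) x = 0.
Proof. by rewrite /dlap big1 // => i _; ring. Qed.

Lemma dlapD (R : realType) (d : nat) (h : R) (f g : 'rV[R]_d -> R) x :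
  dlap h (fun y => f y + g y) x = dlap h f x + dlap h g x.
Proof. by rewrite /dlap -big_split; apply: eq_bigr => i _ /=; ring. Qed.

Lemma dlapZ (R : realType) (d : nat) (h c : R) (f : 'rV[R]_d -> R) x :
  dlap h (fun y => c * f y) x = c * dlap h f x.
Proof. by rewrite /dlap mulr_sumr; apply: eq_bigr => i _; ring. Qed.

Lemma dlapB (R : realType) (d : nat) (h : R) (f g : 'rV[R]_d -> R) x :
  dlap h (fun y => f y - g y) x = dlap h f x - dlap h g x.
Proof. by rewrite /dlap -sumrB; apply: eq_bigr => i _; ring. Qed.

Lemma dlap_shift (R : realType) (d : nat) (h : R) (f : 'rV[R]_d -> R) a x :
  dlap h (fun y => f (y + a)) x = dlap h f (x + a).
Proof.
by apply: eq_bigr => i _; rewrite (addrAC x a) (addrAC x a).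
Qed.

Lemma le_dlap (R : realType) (d : nat) (h : R) (f g : 'rV[R]_d -> R) x :
  (forall y, f y <= g y) -> f x = g x -> dlap h f x <= dlap h g x.
Proof.
by move=> fg fgx; apply: ler_sum => i _; rewrite fgx lerB// lerD.
Qed.

Lemma least_supersol_le (R : realType) (d : nat) (h : R)
    (Psi v : 'rV[R]_d -> R) x :
  supersol h Psi v -> least_supersol h Psi x <= v x.
Proof.
move=> sv; apply: ge_inf; last by exists v.
by exists 0 => _ [u [u0 _ _] <-].
Qed.

Lemma supersol1 (R : realType) (d : nat) (h : R) (Psi : 'rV[R]_d -> R) :
  (forall x, Psi x <= 1) -> supersol h Psi (fun=> 1).
Proof. by move=> P1; split=> // x; rewrite dlap_cst. Qed.

Lemma le_least_supersol (R : realType) (d : nat) (h : R)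
    (Psi : 'rV[R]_d -> R) x a :
  (forall y, Psi y <= 1) -> (forall v, supersol h Psi v -> a <= v x) ->
  a <= least_supersol h Psi x.
Proof.
move=> P1 ale; apply: lb_le_inf; last by move=> _ [v sv <-]; exact: ale.
by exists 1, (fun=> 1) => //; exact: supersol1.
Qed.

(** Superharmonicity bounds [2 d v(x)] from below by the sum of [v] over the neighbours, hence by
    the sum of the infimum there; then the infimum over [v] is taken on the left. *)
Lemma least_supersolP (R : realType) (d : nat) (h : R) (Psi : 'rV[R]_d -> R) :
  (forall y, Psi y <= 1) -> supersol h Psi (least_supersol h Psi).
Proof.
move=> P1; split=> x.
- by apply: le_least_supersol => // v [].
- by apply: le_least_supersol => // v [].
set w := least_supersol h Psi.
rewrite /dlap sumrB -mulr_sumr subr_le0 sumr_const card_ord.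
case: d => [|d] in Psi P1 x w *; first by rewrite big_ord0 mulr0n mulr0.
have d0 : 0 < 2 * d.+1%:R :> R by rewrite mulr_gt0.
rewrite -[w x *+ _]mulr_natl mulrA -ler_pdivrMl //.
apply: le_least_supersol => // v sv; have [_ _ /(_ x)] := sv.
rewrite ler_pdivrMl // /dlap sumrB -mulr_sumr subr_le0 sumr_const card_ord.
rewrite -[v x *+ _]mulr_natl mulrA; apply: le_trans.
by apply: ler_sum => i _; rewrite lerD// least_supersol_le.
Qed.

Lemma nbr_neq (R : realType) (d : nat) (h : R) (x : 'rV[R]_d) (i : 'I_d) :
  h != 0 -> (x + h *: 'e_i != x) /\ (x - h *: 'e_i != x).
Proof.
move=> h0; split; apply/eqP => /(congr1 (fun y : 'rV_d => y 0 i - x 0 i));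
  rewrite !mxE !eqxx /= mulr1 => E; case/negP: h0; apply/eqP; lra.
Qed.

(* Where the least supersolution vanishes it attains its minimum, so all its
   neighbours vanish too: contact with the constraint [0 <= v] is harmless. *)
Lemma least_supersol_harmonic (R : realType) (d : nat) (h : R)
    (Psi : 'rV[R]_d -> R) x :
  h != 0 -> (forall y, Psi y <= 1) -> Psi x < least_supersol h Psi x ->
  dlap h (least_supersol h Psi) x = 0.
Proof.
move=> h0 P1 Px; have [w0 wP wS] := least_supersolP h P1.
set w := least_supersol h Psi in w0 wP wS Px *.
apply/eqP; rewrite eq_le wS /= leNgt; apply/negP => Lx.
have wx : 0 < w x.
  rewrite lt_neqAle w0 andbT eq_sym; apply/negP => /eqP wx0.
  move: Lx; rewrite ltNge => /negP; apply; apply: sumr_ge0 => i _.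
  by rewrite wx0 mulr0 subr0 addr_ge0.
case: d => [|d] in Psi P1 x w w0 wP wS Px Lx wx *.
  by move: Lx; rewrite /dlap big_ord0 ltxx.
have d0 : 0 < 2 * d.+1%:R :> R by rewrite mulr_gt0.
(* Lowering [w] by [a] at the single point [x] keeps a supersolution: the three bounds protect
   nonnegativity, the obstacle condition, and superharmonicity at [x], where [dlap] grows by
   [2 d a]. At other points [dlap] can only decrease. *)
pose a := Num.min (Num.min (w x) (w x - Psi x)) (- dlap h w x / (2 * d.+1%:R)).
have a0 : 0 < a.
  by rewrite !lt_min wx subr_gt0 Px /= divr_gt0 // oppr_gt0.
have [a1 a2 a3] : [/\ a <= w x, a <= w x - Psi x &
    a <= - dlap h w x / (2 * d.+1%:R)].
  by split; rewrite /a !ge_min lexx ?orbT.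
pose v y := if y == x then w x - a else w y.
have vw y : v y <= w y by rewrite /v; case: eqP => [->|//]; rewrite gerBl ltW.
have sv : supersol h Psi v.
  split=> y; rewrite ?/v.
  - by case: eqP => // _; lra.
  - by case: eqP => [->|_] //; lra.
  - case: (eqVneq y x) => [->|yx]; last first.
      by apply: le_trans (wS y); apply: le_dlap => //; rewrite /v (negbTE yx).
    have -> : dlap h v x = dlap h w x + 2 * d.+1%:R * a.
      rewrite -mulrA mulrCA mulr_natl -[X in _ *+ X]card_ord -sumr_const.
      rewrite -big_split; apply: eq_bigr => i _ /=; rewrite /v eqxx.
      by have [/negbTE -> /negbTE ->] := nbr_neq x i h0; ring.
    by move: a3; rewrite ler_pdivlMr // => a3; lra.
have := least_supersol_le x sv.
by rewrite -/w /v eqxx lerBrDr gerDl leNgt a0.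
Qed.

(* Translating and lifting a supersolution by [L `|tau|] gives a
   supersolution. *)
Lemma least_supersol_lip (R : realType) (d : nat) (h L : R)
    (Psi : 'rV[R]_d -> R) :
  (forall y, Psi y <= 1) -> 0 <= L ->
  (forall x y, Psi x <= Num.max 0 (Psi y) + L * `|x - y|) ->
  forall x y, `|least_supersol h Psi x - least_supersol h Psi y| <=
    L * `|x - y|.
Proof.
move=> P1 L0 PL; set w := least_supersol h Psi.
have [w0 wP wS] := least_supersolP h P1.
suff H x y : w x <= w y + L * `|x - y|.
  move=> x y; have := H x y; have := H y x.
  by rewrite [`|y - x|]distrC ler_norml => ? ?; apply/andP; split; lra.
pose v z := w (z + (y - x)) + L * `|x - y|.
have sv : supersol h Psi v.
  split=> z.
  - by rewrite addr_ge0 // mulr_ge0.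
  - apply: le_trans (PL z (z + (y - x))) _.
    have -> : z - (z + (y - x)) = x - y by rewrite !opprD opprK addrA subrr add0r addrC.
    by rewrite /v lerD2r ge_max w0 wP.
  - by rewrite /v dlapD dlap_cst addr0 (dlap_shift h w).
by have := least_supersol_le x sv; rewrite /v [x + _]addrC subrK.
Qed.

(** The average of the translates of [w] by [h] and [-h] along [e_i], raised by [C h^2 / 2], is a
    competitor. Since competitors only have to be nonnegative where [Psi <= 0], the obstacle needs
    to be semiconvex only where it is positive. *)
Lemma least_supersol_semiconvex (R : realType) (d : nat) (h C : R)
    (Psi : 'rV[R]_d -> R) (i : 'I_d) :
  (forall y, Psi y <= 1) -> 0 <= C ->
  (forall x, 0 < Psi x ->
     - (C * h ^+ 2) <= Psi (x + h *: 'e_i) + Psi (x - h *: 'e_i) - 2 * Psi x) ->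
  let w := least_supersol h Psi in
  forall x, - (C * h ^+ 2) <= w (x + h *: 'e_i) + w (x - h *: 'e_i) - 2 * w x.
Proof.
move=> P1 C0 PC w x; have [w0 wP wS] := least_supersolP h P1.
pose v z := 2^-1 * (w (z + h *: 'e_i) + w (z + (- (h *: 'e_i))))
  + 2^-1 * (C * h ^+ 2).
have Ch : 0 <= C * h ^+ 2 by rewrite mulr_ge0 // sqr_ge0.
have sv : supersol h Psi v.
  split=> z.
  - by have := w0 (z + h *: 'e_i); have := w0 (z - h *: 'e_i); rewrite -/w /v; lra.
  - have [Pz|Pz] := lerP (Psi z) 0.
      apply: le_trans Pz _.
      by have := w0 (z + h *: 'e_i); have := w0 (z - h *: 'e_i); rewrite -/w /v; lra.
    have := PC z Pz; have := wP (z + h *: 'e_i).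
    have := wP (z - h *: 'e_i); rewrite -/w /v; lra.
  - rewrite /v dlapD dlap_cst addr0 dlapZ dlapD !dlap_shift.
    have := wS (z + h *: 'e_i); have := wS (z - h *: 'e_i); rewrite -/w; lra.
by have := least_supersol_le x sv; rewrite -/w /v; lra.
Qed.

(** * Symmetries: reflections and coordinate permutations *)

Definition signed_perm (R : realType) (d : nat) (s : 'I_d -> R)
    (p : 'I_d -> 'I_d) (x : 'rV[R]_d) : 'rV[R]_d :=
  \row_i (s i * x 0 (p i)).

Lemma dlap_signed_perm (R : realType) (d : nat) (h : R) (s : 'I_d -> R)
    (p : 'I_d -> 'I_d) (f : 'rV[R]_d -> R) x :
  involutive p -> (forall i, s i = 1 \/ s i = - 1) ->
  dlap h (fun y => f (signed_perm s p y)) x = dlap h f (signed_perm s p x).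
Proof.
move=> pK s1; rewrite /dlap (reindex_inj (inv_inj pK)).
apply: eq_bigr => i _.
have E c : signed_perm s p (x + c *: 'e_(p i)) =
    signed_perm s p x + (s i * c) *: 'e_i.
  apply/rowP => j; rewrite !mxE /= (inj_eq (inv_inj pK)).
  by case: eqP => [->|_]; rewrite /=; ring.
rewrite E -scaleNr E; case: (s1 i) => ->; rewrite ?mul1r ?mulN1r ?opprK scaleNr //.
by rewrite [X in X - _]addrC.
Qed.

(** The condition [s (p i) = s i] makes the symmetry its own inverse, so the inequality given by
    minimality can be applied twice to yield equality. *)
Lemma least_supersol_signed_perm (R : realType) (d : nat) (h : R)
    (Psi : 'rV[R]_d -> R) (s : 'I_d -> R) (p : 'I_d -> 'I_d) :
  (forall y, Psi y <= 1) -> involutive p ->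
  (forall i, s i = 1 \/ s i = - 1) -> (forall i, s (p i) = s i) ->
  (forall x, Psi (signed_perm s p x) = Psi x) ->
  forall x, least_supersol h Psi (signed_perm s p x) = least_supersol h Psi x.
Proof.
move=> P1 pK s1 sp Pg; set w := least_supersol h Psi.
have [w0 wP wS] := least_supersolP h P1.
have gK x : signed_perm s p (signed_perm s p x) = x.
  apply/rowP => j; rewrite !mxE pK sp mulrA.
  by case: (s1 j) => ->; rewrite ?mulrNN !mul1r.
have le x : w x <= w (signed_perm s p x).
  apply: (@least_supersol_le _ _ _ _ (fun y => w (signed_perm s p y))).
  split=> y; first exact: w0.
    by rewrite -Pg; exact: wP.
  by rewrite dlap_signed_perm //; exact: wS.
by move=> x; apply/eqP; rewrite eq_le le andbT -{2}[x]gK le.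
Qed.

(** * Interior gradient bounds *)

Lemma rV_coord_le_norm (R : realType) (d : nat) (x : 'rV[R]_d) (i : 'I_d) :
  `|x 0 i| <= `|x|.
Proof.
rewrite [`|x|]mx_normrE; exact: (@le_bigmax _ _ _ 0 (fun p => `|x p.1 p.2|) (0, i)).
Qed.

Lemma rV_norm_le (R : realType) (d : nat) (x : 'rV[R]_d) (r : R) :
  0 <= r -> (forall i, `|x 0 i| <= r) -> `|x| <= r.
Proof.
move=> r0 H; rewrite [`|x|]mx_normrE; apply: bigmax_le => // -[a b] _ /=.
by rewrite ord1.
Qed.

Lemma norm_scale_unit (R : realType) (d : nat) (t : R) (i : 'I_d) :
  `|t *: 'e_i : 'rV[R]_d| <= `|t|.
Proof.
apply: rV_norm_le => // j; rewrite !mxE normrM ler_piMr //.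
by case: (j == i); rewrite /= ?normr1 ?normr0.
Qed.

(** [G] is only bounded above on [A], so its supremum need not be attained. The uniform bound [eta]
    compensates: at a point within [e] of the supremum every second difference is at most [2 e],
    which contradicts [eta <= dlap h G y] once [2 d e < eta]. *)
Lemma discrete_maximum_principle (R : realType) (d : nat) (h eta b : R)
    (A : set 'rV[R]_d) (G : 'rV[R]_d -> R) :
  0 < eta -> (forall y, A y -> G y <= b) ->
  (forall y, A y -> 0 < G y -> eta <= dlap h G y /\
     forall j, (A (y + h *: 'e_j) \/ G (y + h *: 'e_j) <= 0) /\
               (A (y - h *: 'e_j) \/ G (y - h *: 'e_j) <= 0)) ->
  forall y, A y -> G y <= 0.
Proof.
move=> eta0 Gb HG y0 Ay0; rewrite leNgt; apply/negP => Gy0.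
have hs : has_sup [set G y | y in A].
  by split; [exists (G y0), y0|exists b => _ [y Ay <-]; exact: Gb].
set S := sup [set G y | y in A].
have GS y : A y -> G y <= S by move=> Ay; apply: ub_le_sup; [case: hs|exists y].
have S0 : 0 < S := lt_le_trans Gy0 (GS _ Ay0).
(* [e <= S] makes [G] positive at the chosen point; [d.+1] keeps the quotient meaningful when
   [d = 0]. *)
pose e := Num.min S (eta / (2 * d.+1%:R)).
have e0 : 0 < e by rewrite lt_min S0 divr_gt0.
have [_ [y Ay <-] Gy] := sup_adherent e0 hs.
have Gy1 : 0 < G y.
  by apply: le_lt_trans Gy; rewrite subr_ge0 /e ge_min lexx.
have [L nb] := HG y Ay Gy1.
have : dlap h G y <= \sum_(i < d) (2 * e).
  apply: ler_sum => i _; have [np nm] := nb i.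
  have Gp : G (y + h *: 'e_i) <= S by case: np => [/GS//|/le_trans]; apply; exact: ltW.
  have Gm : G (y - h *: 'e_i) <= S by case: nm => [/GS//|/le_trans]; apply; exact: ltW.
  by move: Gy; rewrite -/S; lra.
rewrite sumr_const card_ord -mulr_natl => L2.
have e1 : e <= eta / (2 * d.+1%:R) by rewrite /e ge_min lexx orbT.
move: e1; rewrite ler_pdivlMr // -natr1 => e1.
move: L L2 e0 e1; move: (dlap h G y) => X; nra.
Qed.

(* The odd reflection [g y = f y - f (sigma y)] across the plane
   [y_i = h / 2] vanishes there in the discrete sense, and is compared with a
   quadratic barrier that vanishes on the same plane. *)
Lemma discrete_gradient_le (R : realType) (d : nat) (h rho M : R)
    (f : 'rV[R]_d -> R) (c : 'rV[R]_d) (i : 'I_d) :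
  0 < h -> 2 * h <= rho -> 0 < M ->
  (forall x, `|x - c| <= rho -> `|f x| <= M) ->
  (forall x, `|x - c| <= rho -> dlap h f x = 0) ->
  f (c + h *: 'e_i) - f c <= 4 * d%:R * M * h / rho.
Proof.
move=> h0 hrho M0 fM fH.
pose a := rho - h; have ah : h <= a by rewrite /a; lra.
have ar : a + h = rho by rewrite /a; ring.
have a0 : 0 < a by lra.
have d1 : 1 <= d%:R :> R by rewrite ler1n; case: (d) i => [[]|].
(* [sg] is the reflection [y_i -> h - y_i]. It exchanges [0] and [h e_i], so [g] at [h e_i] is
   exactly the increment to be bounded. *)
pose s (j : 'I_d) : R := if j == i then -1 else 1.
pose sg y := signed_perm s id y + h *: 'e_i.
have sgi y : sg y 0 i = h - y 0 i by rewrite !mxE /s !eqxx /=; ring.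
have sgj y j : j != i -> sg y 0 j = y 0 j.
  by move=> ji; rewrite !mxE /s (negbTE ji) /=; ring.
pose g y := f (y + c) - f (sg y + c).
pose N (y : 'rV[R]_d) := \sum_(j < d) y 0 j ^+ 2.
(* The weight [d] makes the concave part in [y_i] outweigh the other squares: [dlap h E = - 2 h^2].
   Moreover [E >= a^2] at points of [A] having a coordinate of size at least [a], and [k] is chosen
   so that [k a^2] is the bound [2 M] on [g]. *)
pose E y := N y - y 0 i ^+ 2 +
   d%:R * ((2 * y 0 i - h) * a - y 0 i ^+ 2 + h * y 0 i).
pose k := 2 * M / a ^+ 2.
have k0 : 0 < k by rewrite divr_gt0 ?exprn_gt0 // mulr_gt0.
have ka : k * a ^+ 2 = 2 * M by rewrite /k; field; rewrite gt_eqF.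
pose G y := g y - k * E y.
(* Only the coordinate [y_i] is restricted to positive multiples of [h]. A downward step from the
   first layer therefore lands on layer 0, the mirror image of that layer. *)
pose A := [set y : 'rV[R]_d | (exists2 m : nat, (0 < m)%N & y 0 i = m%:R * h) /\
   `|y| <= rho].
have Nj (y : 'rV[R]_d) j : j != i -> y 0 j ^+ 2 <= N y - y 0 i ^+ 2.
  move=> ji; rewrite /N (bigD1 i) //= (bigD1 j) //= addrAC subrr add0r lerDl.
  by apply: sumr_ge0 => ? _; exact: sqr_ge0.
have N0 (y : 'rV[R]_d) : 0 <= N y - y 0 i ^+ 2.
  rewrite /N (bigD1 i) //= addrAC subrr add0r.
  by apply: sumr_ge0 => ? _; exact: sqr_ge0.
have Ai y : A y -> h <= y 0 i <= a + h.
  case=> -[m m0 ym] yr; apply/andP; split.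
    by rewrite ym ler_peMl ?ler1n // ltW.
  have := rV_coord_le_norm y i; have := ler_norm (y 0 i); rewrite /a; lra.
have E2 y : A y -> 0 <= (2 * y 0 i - h) * a - y 0 i ^+ 2 + h * y 0 i.
  by move=> /Ai /andP[]; move: (y 0 i) => t *; nra.
have E0 y : A y -> 0 <= E y.
  by move=> Ay; rewrite addr_ge0 ?N0 // mulr_ge0 ?E2 //; lra.
have sgr y : A y -> `|sg y| <= rho.
  move=> Ay; apply: rV_norm_le => [|j]; first lra.
  have [->|ji] := eqVneq j i.
    have /andP[y1 y2] := Ai y Ay.
    by rewrite sgi ler_norml; apply/andP; split; lra.
  by rewrite sgj //; apply: le_trans (rV_coord_le_norm _ _) _; case: Ay.
have gM y : A y -> g y <= 2 * M.
  move=> Ay; have := fM (y + c); have := fM (sg y + c).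
  rewrite !addrK => /(_ (sgr y Ay)) H1 /(_ Ay.2) H2.
  by move: H1 H2; rewrite !ler_norml /g => /andP[? ?] /andP[? ?]; lra.
have gH y : A y -> dlap h g y = 0.
  move=> Ay; rewrite /g dlapB (dlap_shift h f).
  have -> : dlap h (fun y0 => f (sg y0 + c)) y = dlap h f (sg y + c).
    have -> : (fun y0 => f (sg y0 + c)) =
        (fun y0 => (fun z => f (z + (h *: 'e_i + c))) (signed_perm s id y0)).
      by apply/funext => z; rewrite /sg addrA.
    rewrite (dlap_signed_perm h (fun z => f (z + (h *: 'e_i + c)))) //.
      by rewrite dlap_shift /sg addrA.
    by move=> j; rewrite /s; case: (j == i); [right|left].
  by rewrite !fH ?addrK ?subrr //; [exact: sgr|case: Ay].
have unitE (j l : 'I_d) : ('e_j : 'rV[R]_d) 0 l = (l == j)%:R.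
  by rewrite mxE eqxx.
have EH y : dlap h E y = - (2 * h ^+ 2).
  have dN : dlap h N y = 2 * d%:R * h ^+ 2.
    rewrite /dlap (eq_bigr (fun=> 2 * h ^+ 2)).
      by rewrite sumr_const card_ord -[_ *+ _]mulr_natl; ring.
    move=> j _; rewrite /N mulr_sumr -big_split -sumrB /= (bigD1 j) //=.
    rewrite big1 ?addr0 => [|l lj]; rewrite !mxE ?eqxx ?(negbTE lj) /=; ring.
  have dyi (b q : R) : dlap h (fun y : 'rV[R]_d => b * y 0 i ^+ 2 + q * y 0 i) y =
      2 * b * h ^+ 2.
    rewrite /dlap (bigD1 i) //= big1 ?addr0 => [|l lj]; rewrite !mxE ?eqxx /=.
      ring.
    by rewrite eq_sym (negbTE lj) /=; ring.
  have -> : E = (fun y => (N y + ((- 1 - d%:R) * y 0 i ^+ 2 +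
       d%:R * (2 * a + h) * y 0 i)) + - (d%:R * h * a)).
    by apply/funext => z; rewrite /E; ring.
  by rewrite dlapD dlap_cst dlapD dyi dN; ring.
suff GA : forall y, A y -> G y <= 0.
  have /GA : A (h *: 'e_i).
    split; first by exists 1%N => //; rewrite !mxE !eqxx /=; ring.
    by apply: le_trans (norm_scale_unit _ _) _; rewrite gtr0_norm //; lra.
  have hi : (h *: 'e_i : 'rV[R]_d) 0 i = h by rewrite !mxE !eqxx /=; ring.
  have -> : G (h *: 'e_i) = f (c + h *: 'e_i) - f c - k * (d%:R * h * a).
    rewrite /G /g; have -> : sg (h *: 'e_i) = 0.
      apply/rowP => j; have [->|ji] := eqVneq j i.
        by rewrite sgi hi !mxE subrr.
      by rewrite sgj // !mxE (negbTE ji) andbF /= mulr0.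
    rewrite add0r [c + _]addrC /E hi.
    have -> : N (h *: 'e_i) = h ^+ 2.
      rewrite /N (bigD1 i) //= big1 ?addr0 ?hi // => j ji.
      by rewrite !mxE (negbTE ji) andbF /= mulr0 expr0n.
    ring.
  rewrite subr_le0 => /le_trans; apply.
  rewrite ler_pdivlMr; last lra.
  have -> : k * (d%:R * h * a) * rho = (2 * d%:R * M * h / a) * rho.
    by rewrite /k; field; rewrite gt_eqF.
  have -> : 4 * d%:R * M * h = (2 * d%:R * M * h / a) * (2 * a).
    by field; rewrite gt_eqF.
  (* [2 h <= rho] gives [rho <= 2 a], which accounts for the factor 4. *)
  rewrite ler_wpM2l //; last by rewrite /a; lra.
  by rewrite divr_ge0 ?(ltW a0) // !mulr_ge0 // ltW.
have kh : 0 < k * (2 * h ^+ 2) by rewrite mulr_gt0 // mulr_gt0 // exprn_gt0.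
apply: (discrete_maximum_principle (h := h) kh (b := 2 * M)) => y Ay.
  by apply: le_trans (gM y Ay); rewrite /G gerBl mulr_ge0 ?E0 // ltW.
move=> Gy; split.
  by rewrite /G dlapB gH // dlapZ EH sub0r -mulrN opprK.
(* If some coordinate exceeded [a], then [k E >= 2 M >= g], against [0 < G y]. So points where [G]
   is positive stay one step away from the outer boundary. *)
have inner j : `|y 0 j| <= a.
  rewrite leNgt; apply/negP => yj; move: Gy; apply/negP; rewrite -leNgt subr_le0.
  apply: le_trans (gM y Ay) _; rewrite -ka ler_pM2l //.
  have ya : a ^+ 2 <= y 0 j ^+ 2.
    by rewrite -[leRHS]real_normK ?num_real // ler_pXn2r // ?nnegrE // ltW.
  have [ji|ji] := eqVneq j i; last first.
    have := Nj y j ji; have := E2 y Ay; rewrite /E => X1 X2.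
    have : 0 <= d%:R * ((2 * y 0 i - h) * a - y 0 i ^+ 2 + h * y 0 i).
      by rewrite mulr_ge0 //; lra.
    lra.
  have /andP[y1 y2] := Ai y Ay.
  have y3 : a <= y 0 i by move: yj; rewrite ji ger0_norm; lra.
  have X1 : a ^+ 2 <= (2 * y 0 i - h) * a - y 0 i ^+ 2 + h * y 0 i.
    by move: (y 0 i) y1 y2 y3 => t *; nra.
  apply: le_trans X1 _; rewrite /E -[leLHS]add0r lerD ?N0 //.
  by rewrite ler_peMl // E2.
have nbr_in (j : 'I_d) (b : R) : `|b| = h -> `|y + b *: 'e_j| <= rho.
  move=> bh; apply: rV_norm_le => [|l]; first lra.
  rewrite !mxE; apply: le_trans (ler_normD _ _) _.
  have := inner l; rewrite normrM bh.
  by case: (_ && _) => /=; rewrite ?normr1 ?normr0 /a; lra.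
have bh : `|h| = h by rewrite gtr0_norm.
have bh' : `|- h| = h by rewrite normrN.
have [[m m0 ym] _] := Ay.
move=> j; rewrite -scaleNr; have [->|ji] := eqVneq j i; last first.
  split; left; (split; [exists m => //|exact: nbr_in]);
    by rewrite !mxE eq_sym (negbTE ji) andbF ym /=; ring.
split.
  left; split; last exact: nbr_in.
  by exists m.+1 => //; rewrite !mxE !eqxx ym -natr1 /=; ring.
have [m1|m1] := eqVneq m 1%N; last first.
  left; split; last exact: nbr_in.
  exists m.-1; first by case: m m0 m1 {ym} => [|[]].
  by rewrite !mxE !eqxx ym -[in LHS](prednK m0) -natr1 /=; ring.
(* From the first layer the lower neighbour [z] is the reflection of [y]: [g] changes sign and the
   term [d h a] of [E] too, so [G z = - G y - 2 k (N y - y_i^2)], which is nonpositive. *)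
right; have yh : y 0 i = h by rewrite ym m1 mul1r.
set z := y + (- h) *: 'e_i.
have zi : z 0 i = 0 by rewrite !mxE !eqxx yh /=; ring.
have zj l : l != i -> z 0 l = y 0 l.
  by move=> li; rewrite !mxE (negbTE li) andbF /= mulr0 addr0.
have sz : sg z = y.
  apply/rowP => l; have [->|li] := eqVneq l i; first by rewrite sgi zi yh subr0.
  by rewrite sgj // zj.
have sy : sg y = z.
  apply/rowP => l; have [->|li] := eqVneq l i; first by rewrite sgi zi yh subrr.
  by rewrite sgj // zj.
have NE : N z - z 0 i ^+ 2 = N y - y 0 i ^+ 2.
  rewrite /N (bigD1 i) //= [in RHS](bigD1 i) //=.
  rewrite (eq_bigr (fun l => y 0 l ^+ 2)) => [|l /zj -> //]; ring.
have gz : g z = - g y by rewrite /g sz sy opprB.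
have EE : E z = (N y - y 0 i ^+ 2) - d%:R * h * a.
  by rewrite /E NE zi; ring.
have EE' : E y = (N y - y 0 i ^+ 2) + d%:R * h * a.
  by rewrite /E yh; ring.
rewrite /G gz; move: Gy; rewrite /G EE EE'; have := N0 y.
have := mulr_ge0 (ltW k0) (N0 y); lra.
Qed.

(** * Second-order jets *)

Lemma is_derive_quad (R : realType) (V : normedModType R) (f : V -> R) (x v : V)
    (l C r : R) :
  0 < r ->
  (forall s, `|s| < r -> `|f (x + s *: v) - f x - s * l| <= C * s ^+ 2) ->
  is_derive x v f l.
Proof.
move=> r0 H.
have cv : (fun h => h^-1 *: ((f \o shift x) (h *: v) - f x)) @ 0^' --> l.
  apply/cvgrPdist_le => e e0; near=> s.
  have s0 : s != 0 by near: s; exact: nbhs_dnbhs_neq.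
  have ps : 0 < `|s| by rewrite normr_gt0.
  have -> : l - s^-1 *: ((f \o shift x) (s *: v) - f x) =
      - (s^-1 * (f (x + s *: v) - f x - s * l)).
    rewrite /= /GRing.scale /= [s *: v + x]addrC; field.
    by [].
  rewrite normrN normrM normfV ler_pdivrMl //.
  have sr : `|s| < r.
    near: s; exact: dnbhs0_lt.
  apply: le_trans (H s sr) _; rewrite -real_normK ?num_real // expr2 mulrCA.
  rewrite ler_pM2l //.
  have sC : `|s| < e / (`|C| + 1).
    by near: s; apply: dnbhs0_lt; rewrite divr_gt0 // ltr_wpDl.
  move: sC; rewrite ltr_pdivlMr ?ltr_wpDl // => sC.
  have : C * `|s| <= `|C| * `|s| by rewrite ler_wpM2r // ler_norm.
  nra.
apply: DeriveDef; first by apply/cvg_ex; exists l.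
exact: cvg_lim cv.
Unshelve. all: by end_near. Qed.

Lemma is_derive_inv (R : realType) (V : normedModType R) (f : V -> R) (x v : V)
    (l : R) :
  f x != 0 -> is_derive x v f l ->
  is_derive x v (fun y => (f y)^-1) (- ((f x)^-1 * (f x)^-1 * l)).
Proof.
move=> f0 [df <-]; apply: DeriveDef; first exact: derivableV.
by rewrite deriveV // /GRing.scale /= mulNr expr2 invfM.
Qed.

(* [g] and [H] are the gradient and the Hessian of [f] on [A]. *)
Definition jet2_on (R : realType) (d : nat) (A : set 'rV[R]_d)
    (f : 'rV[R]_d -> R) (g : 'I_d -> 'rV[R]_d -> R)
    (H : 'I_d -> 'I_d -> 'rV[R]_d -> R) : Prop :=
  forall x, A x ->
    [/\ {for x, continuous f},
        forall i, is_derive x 'e_i f (g i x) /\ {for x, continuous (g i)} &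
        forall i j, is_derive x 'e_j (g i) (H i j x) /\
                    {for x, continuous (H i j)}].

Lemma near_eq_continuous (R : realType) (T : topologicalType) (f g : T -> R) x :
  (\near x, f x = g x) -> {for x, continuous g} -> {for x, continuous f}.
Proof.
move=> fg cg; have fgx : f x = g x := nbhs_singleton fg.
rewrite /prop_for /continuous_at fgx; apply: cvg_trans cg; apply: near_eq_cvg.
by apply: filterS fg => y /= ->.
Qed.

Lemma jet2_partial (R : realType) (d : nat) (A : set 'rV[R]_d) f g H :
  jet2_on A f g H -> forall x i, A x -> partial i f x = g i x.
Proof. by move=> J x i /J[_ /(_ i) [[_ <-]]]. Qed.

Lemma jet2_near (R : realType) (d : nat) (A : set 'rV[R]_d) f g H :
  open A -> jet2_on A f g H -> forall x i, A x ->
  \near x, partial i f x = g i x.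
Proof.
move=> oA J x i Ax; have : nbhs x A by exact: open_nbhs_nbhs.
by apply: filterS => y Ay; exact: jet2_partial J y i Ay.
Qed.

Lemma jet2_partial2 (R : realType) (d : nat) (A : set 'rV[R]_d) f g H :
  open A -> jet2_on A f g H -> forall x i j, A x ->
  is_derive x 'e_j (partial i f) (H i j x).
Proof.
move=> oA J x i j Ax; have [_ _ /(_ i j) [D _]] := J x Ax.
apply: near_eq_is_derive D; apply: filterS (jet2_near oA J i Ax).
by move=> y ->.
Qed.

Lemma jet2_C2_on (R : realType) (d : nat) (A : set 'rV[R]_d) f g H :
  open A -> jet2_on A f g H -> C2_on A f.
Proof.
move=> oA J x Ax; have [cf dg dH] := J x Ax; split=> // [i|i j].
  split; first by have [[]] := dg i.
  exact: near_eq_continuous (jet2_near oA J i Ax) (dg i).2.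
split; first by have [] := jet2_partial2 oA J i j Ax.
apply: near_eq_continuous (dH i j).2.
have : nbhs x A by exact: open_nbhs_nbhs.
by apply: filterS => y Ay; have [_] := jet2_partial2 oA J i j Ay.
Qed.

Lemma jet2_laplacian (R : realType) (d : nat) (A : set 'rV[R]_d) f g H x :
  open A -> jet2_on A f g H -> A x -> laplacian f x = \sum_(i < d) H i i x.
Proof.
move=> oA J Ax; apply: eq_bigr => i _.
by have [_] := jet2_partial2 oA J i i Ax.
Qed.

Lemma C2_on_jet2 (R : realType) (d : nat) (A : set 'rV[R]_d) f :
  C2_on A f ->
  jet2_on A f (fun i => partial i f) (fun i j => partial j (partial i f)).
Proof.
move=> Cf x Ax; have [cf dg dH] := Cf x Ax; split=> // [i|i j].
  by have [? ?] := dg i; split=> //; exact: DeriveDef.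
by have [? ?] := dH i j; split=> //; exact: DeriveDef.
Qed.

Lemma jet2_cst (R : realType) (d : nat) (A : set 'rV[R]_d) c :
  jet2_on A (fun=> c) (fun _ _ => 0) (fun _ _ _ => 0).
Proof.
by move=> x _; split=> [|i|i j]; try split; try exact: cst_continuous;
  exact: is_derive_cst.
Qed.

Lemma jet2_coord (R : realType) (d : nat) (A : set 'rV[R]_d) (k : 'I_d) :
  jet2_on A (fun y => y 0 k) (fun i _ => (k == i)%:R) (fun _ _ _ => 0).
Proof.
move=> x _; split=> [|i|i j]; first exact: coord_continuous.
  split; last exact: cst_continuous.
  apply: (@is_derive_quad _ _ _ _ _ _ 0 1) => // s _.
  by rewrite !mxE eqxx /= mul0r normr_le0; apply/eqP; ring.
by split; [exact: is_derive_cst | exact: cst_continuous].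
Qed.

Lemma jet2D (R : realType) (d : nat) (A : set 'rV[R]_d) f1 g1 H1 f2 g2 H2 :
  jet2_on A f1 g1 H1 -> jet2_on A f2 g2 H2 ->
  jet2_on A (fun y => f1 y + f2 y) (fun i y => g1 i y + g2 i y)
    (fun i j y => H1 i j y + H2 i j y).
Proof.
move=> J1 J2 x Ax; have [c1 d1 h1] := J1 x Ax; have [c2 d2 h2] := J2 x Ax.
split=> [|i|i j]; first exact: continuousD.
  have [a1 b1] := d1 i; have [a2 b2] := d2 i.
  by split; [exact: is_deriveD | exact: continuousD].
have [a1 b1] := h1 i j; have [a2 b2] := h2 i j.
by split; [exact: is_deriveD | exact: continuousD].
Qed.

Lemma is_derive_mul (R : realType) (V : normedModType R) (f1 f2 : V -> R) x v
    (l1 l2 : R) :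
  is_derive x v f1 l1 -> is_derive x v f2 l2 ->
  is_derive x v (fun y => f1 y * f2 y) (l1 * f2 x + f1 x * l2).
Proof.
move=> D1 D2; apply: is_derive_eq (is_deriveM D1 D2) _.
by rewrite /GRing.scale /= addrC mulrC.
Qed.

Lemma jet2M (R : realType) (d : nat) (A : set 'rV[R]_d) f1 g1 H1 f2 g2 H2 :
  jet2_on A f1 g1 H1 -> jet2_on A f2 g2 H2 ->
  jet2_on A (fun y => f1 y * f2 y) (fun i y => g1 i y * f2 y + f1 y * g2 i y)
    (fun i j y => (H1 i j y * f2 y + g1 i y * g2 j y) +
                  (g1 j y * g2 i y + f1 y * H2 i j y)).
Proof.
move=> J1 J2 x Ax; have [c1 d1 h1] := J1 x Ax; have [c2 d2 h2] := J2 x Ax.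
split=> [|i|i j]; first exact: continuousM.
  have [a1 b1] := d1 i; have [a2 b2] := d2 i; split; first exact: is_derive_mul.
  by apply: continuousD; apply: continuousM.
have [a1 b1] := h1 i j; have [a2 b2] := h2 i j.
have [e1 k1] := d1 i; have [e2 k2] := d2 i.
have [e1' k1'] := d1 j; have [e2' k2'] := d2 j; split.
  by apply: is_deriveD; exact: is_derive_mul.
by apply: continuousD; apply: continuousD; apply: continuousM.
Qed.

Lemma jet2Z (R : realType) (d : nat) (A : set 'rV[R]_d) f g H c :
  jet2_on A f g H ->
  jet2_on A (fun y => c * f y) (fun i y => c * g i y) (fun i j y => c * H i j y).
Proof.
move=> J x Ax; have [cf dg dH] := J x Ax.
split=> [|i|i j]; first by apply: continuousM => //; exact: cst_continuous.
  have [a b] := dg i; split; first exact: is_deriveZ.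
  by apply: continuousM => //; exact: cst_continuous.
have [a b] := dH i j; split; first exact: is_deriveZ.
by apply: continuousM => //; exact: cst_continuous.
Qed.

Lemma jet2_inv (R : realType) (d : nat) (A : set 'rV[R]_d) f g H :
  (forall x, A x -> f x != 0) -> jet2_on A f g H ->
  jet2_on A (fun y => (f y)^-1)
    (fun i y => - ((f y)^-1 * (f y)^-1 * g i y))
    (fun i j y => 2 * (f y)^-1 ^+ 3 * g i y * g j y -
      (f y)^-1 ^+ 2 * H i j y).
Proof.
move=> f0 J x Ax; have [cf dg dH] := J x Ax; have fx := f0 x Ax.
have ci : {for x, continuous (fun y => (f y)^-1)} by exact: continuousV.
split=> // [i|i j]; first have [a b] := dg i.
  split; first exact: is_derive_inv.
  by apply: continuousN; apply: continuousM => //; apply: continuousM.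
have [a b] := dH i j; have [a1 b1] := dg i; have [a2 b2] := dg j; split.
  have Di := is_derive_inv fx a2.
  apply: is_derive_eq (is_deriveN (is_derive_mul (is_derive_mul Di Di) a)) _.
  by ring.
apply: continuousB.
  apply: continuousM => //; apply: continuousM => //.
  apply: continuousM; first exact: cst_continuous.
  by rewrite (_ : (fun y => (f y)^-1 ^+ 3) =
    (fun y => (f y)^-1 * ((f y)^-1 * (f y)^-1))) //;
    do 2 apply: continuousM => //.
by apply: continuousM => //;
  rewrite (_ : (fun y => (f y)^-1 ^+ 2) = (fun y => (f y)^-1 * (f y)^-1)) //;
  apply: continuousM.
Qed.

Lemma jet2_sum (R : realType) (d n : nat) (A : set 'rV[R]_d)
    (f : 'I_n -> 'rV[R]_d -> R) (g : 'I_n -> 'I_d -> 'rV[R]_d -> R)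
    (H : 'I_n -> 'I_d -> 'I_d -> 'rV[R]_d -> R) :
  (forall k, jet2_on A (f k) (g k) (H k)) ->
  jet2_on A (fun y => \sum_(k < n) f k y) (fun i y => \sum_(k < n) g k i y)
    (fun i j y => \sum_(k < n) H k i j y).
Proof.
elim: n f g H => [|n IH] f g H J.
  rewrite (_ : (fun y => _) = fun=> 0); last by apply/funext=> y; rewrite big_ord0.
  rewrite (_ : (fun i => _) = fun _ _ => 0); last first.
    by apply/funext=> i; apply/funext => y; rewrite big_ord0.
  rewrite (_ : (fun i => _) = fun _ _ _ => 0); first exact: jet2_cst.
  by apply/funext=> i; apply/funext => j; apply/funext => y; rewrite big_ord0.
have := jet2D (IH _ _ _ (fun k => J (widen_ord (leqnSn n) k))) (J ord_max).
congr (jet2_on _ _ _ _).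
- by apply/funext => y; rewrite big_ord_recr.
- by apply/funext => i; apply/funext => y; rewrite big_ord_recr.
- by apply/funext => i; apply/funext => j; apply/funext => y; rewrite big_ord_recr.
Qed.

Lemma jet2_eq (R : realType) (d : nat) (A : set 'rV[R]_d) f g H f' g' H' :
  (forall x, f x = f' x) -> (forall i x, g i x = g' i x) ->
  (forall i j x, H i j x = H' i j x) -> jet2_on A f g H -> jet2_on A f' g' H'.
Proof.
move=> /funext -> gg HH; have -> : g = g' by do 2 apply/funext => ?.
by have -> : H = H' by do 3 apply/funext => ?.
Qed.

(** * Difference quotients *)

Lemma ultra_fmap (S T : Type) (F : set_system S) (f : S -> T) :
  UltraFilter F -> UltraFilter (fmap f F).
Proof.
move=> UF; split; first exact: fmap_proper_filter.
move=> G GG FG; apply/seteqP; split=> // A GA.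
have [//|nA] := in_ultra_setVsetC (f @^-1` A) UF.
have /FG GnA : fmap f F (~` A) by [].
by have /filter_ex [? []] : G (A `&` ~` A) by exact: filterI.
Qed.

(** Along an ultrafilter every bounded family converges, by compactness of a segment. This replaces
    the extraction of subsequences: one [U] serves all points and all difference quotients
    simultaneously. *)
Lemma ultra_bounded_cvg (R : realType) (S : Type) (U : set_system S)
    (F : S -> R) (M : R) :
  UltraFilter U -> (\forall h \near U, `|F h| <= M) -> F @ U --> lim (F @ U).
Proof.
move=> UU FM; apply/cvg_ex.
have : compact `[- M, M]%classic := @segment_compact _ _ _.
rewrite compact_ultra => /(_ (fmap F U) (ultra_fmap F UU)) [].
  by apply: filterS FM => h; rewrite /= in_itv /= ler_norml.
by move=> l [_ Fl]; exists l.
Qed.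

Lemma ultra_cvg0 (R : realType) (U : set_system R) :
  0^'+ `<=` U -> id @ U --> (0 : R).
Proof.
move=> hU A A0; apply: hU; move: A0; rewrite /at_right /within /=.
by apply: filterS => x ? ?.
Qed.

Lemma cvg_norm_le (R : realType) (U : set_system R) (F : R -> R) (l b K : R) :
  ProperFilter U -> 0^'+ `<=` U -> F @ U --> l ->
  (\forall h \near U, `|F h| <= b + K * h) -> `|l| <= b.
Proof.
move=> PU hU Fl Fb.
have g : (fun h : R => b + K * h) @ U --> b.
  rewrite -[X in _ --> X]addr0 -(mulr0 K); apply: cvgD; first exact: cvg_cst.
  by apply: cvgM; [exact: cvg_cst|exact: (ultra_cvg0 hU)].
exact: (ler_cvg_to (cvg_norm Fl) g Fb).
Qed.

Definition fdiff (R : realType) (d : nat) (h : R) (i : 'I_d)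
    (f : 'rV[R]_d -> R) (x : 'rV[R]_d) : R :=
  h^-1 * (f (x + h *: 'e_i) - f x).

Lemma dlap_fdiff (R : realType) (d : nat) (h : R) (i : 'I_d)
    (f : 'rV[R]_d -> R) x :
  dlap h (fdiff h i f) x = h^-1 * (dlap h f (x + h *: 'e_i) - dlap h f x).
Proof. by rewrite /fdiff dlapZ dlapB dlap_shift. Qed.

(** The difference quotient is again discrete harmonic, so the bound can be iterated. The added 1
    keeps the new bound positive for every [d], as the next application requires. *)
Lemma fdiff_le (R : realType) (d : nat) (h r M : R) (f : 'rV[R]_d -> R)
    (c : 'rV[R]_d) :
  0 < h -> 4 * h <= r -> 0 < M ->
  (forall x, `|x - c| <= r -> `|f x| <= M) ->
  (forall x, `|x - c| <= r -> dlap h f x = 0) ->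
  forall i x, `|x - c| <= r / 2 ->
    `|fdiff h i f x| <= 8 * d%:R * M / r + 1 /\ dlap h (fdiff h i f) x = 0.
Proof.
move=> h0 hr M0 fM fH i x xc; split; last first.
  rewrite dlap_fdiff !fH ?subrr ?mulr0 //; first lra.
  rewrite addrAC; apply: le_trans (ler_normD _ _) _.
  by have := norm_scale_unit h i; rewrite gtr0_norm //; lra.
have inQ y : `|y - x| <= r / 2 -> `|y - c| <= r.
  by move=> yx; have := ler_normD (y - x) (x - c); rewrite addrA subrK; lra.
have r0 : 0 < r by lra.
have A : f (x + h *: 'e_i) - f x <= 4 * d%:R * M * h / (r / 2).
  apply: discrete_gradient_le => //; first lra.
    by move=> y /inQ /fM.
  by move=> y /inQ /fH.
have B : (- f (x + h *: 'e_i)) - (- f x) <= 4 * d%:R * M * h / (r / 2).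
  apply: (@discrete_gradient_le _ _ _ _ _ (fun y => - f y)) => //; first lra.
    by move=> y /inQ /fM; rewrite normrN.
  move=> y /inQ /fH fy.
  have := dlapZ h (-1) f y; rewrite fy mulr0 => <-.
  by congr dlap; apply/funext => z; rewrite mulN1r.
rewrite /fdiff normrM gtr0_norm ?invr_gt0 // ler_pdivrMl //.
have E : 4 * d%:R * M * h / (r / 2) = h * (8 * d%:R * M / r).
  by field; rewrite gt_eqF.
rewrite mulrDr -E ler_norml; apply/andP; split; lra.
Qed.

(** [C] is chosen before [h], [f] and [c]. Second differences converge to the Hessian, and the bound
    on third differences makes that Hessian Lipschitz. *)
Lemma fdiff3_le (R : realType) (d : nat) (r M : R) :
  0 < r -> 0 < M -> exists C : R, forall h (f : 'rV[R]_d -> R) (c : 'rV[R]_d),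
  0 < h -> 16 * h <= r ->
  (forall x, `|x - c| <= r -> `|f x| <= M) ->
  (forall x, `|x - c| <= r -> dlap h f x = 0) ->
  forall x, `|x - c| <= r / 8 ->
  [/\ `|f x| <= C, forall i, `|fdiff h i f x| <= C,
      forall i j, `|fdiff h j (fdiff h i f) x| <= C &
      forall i j l, `|fdiff h l (fdiff h j (fdiff h i f)) x| <= C].
Proof.
move=> r0 M0.
pose K M r : R := 8 * d%:R * M / r + 1.
have K0 M' r' : 0 < M' -> 0 < r' -> 0 < K M' r'.
  by move=> /ltW ? /ltW ?; rewrite ltr_wpDl // divr_ge0 // mulr_ge0 // mulr_ge0.
pose M1 := K M r; pose M2 := K M1 (r / 2); pose M3 := K M2 (r / 4).
have M10 : 0 < M1 by exact: K0.
have M20 : 0 < M2 by apply: K0 => //; lra.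
have M30 : 0 < M3 by apply: K0 => //; lra.
exists (M + M1 + M2 + M3) => h f c h0 hr fM fH x xc.
have e1 : r / 2 / 2 = r / 4 by field.
have e2 : r / 4 / 2 = r / 8 by field.
have hr1 : 4 * h <= r by lra.
have S1 i y (H : `|y - c| <= r / 2) := fdiff_le h0 hr1 M0 fM fH i H.
have hr2 : 4 * h <= r / 2 by lra.
have S2 i j y : `|y - c| <= r / 4 -> `|fdiff h j (fdiff h i f) y| <= M2 /\
     dlap h (fdiff h j (fdiff h i f)) y = 0.
  rewrite -e1; apply: (fdiff_le h0 hr2 M10) => z /(S1 i) [] //.
have hr3 : 4 * h <= r / 4 by lra.
have S3 i j l y : `|y - c| <= r / 8 ->
     `|fdiff h l (fdiff h j (fdiff h i f)) y| <= M3 /\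
     dlap h (fdiff h l (fdiff h j (fdiff h i f))) y = 0.
  rewrite -e2; apply: (fdiff_le h0 hr3 M20) => z /(S2 i j) [] //.
split.
- have := fM x; lra.
- by move=> i; have [|+ _] := S1 i x _; [lra|rewrite -/(K M r) -/M1; lra].
- by move=> i j; have [|+ _] := S2 i j x _; lra.
- by move=> i j l; have [|+ _] := S3 i j l x _; lra.
Qed.

(** Bounds on difference quotients of step [h] control only displacements by multiples of [h] along
    an axis. Rounding both endpoints of a displacement to the grid makes it one. *)
Definition grid_floor (R : realType) (d : nat) (h : R) (x : 'rV[R]_d) :
    'rV[R]_d :=
  \row_i (h * (Num.floor (x 0 i / h))%:~R).

Lemma grid_floor_le (R : realType) (d : nat) (h : R) (x : 'rV[R]_d) :
  0 < h -> `|grid_floor h x - x| <= h.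
Proof.
move=> h0; apply: rV_norm_le => [|i]; first exact: ltW.
rewrite !mxE; have := floor_le (x 0 i / h); have := floorD1_gt (x 0 i / h).
rewrite intrD ltr_pdivrMr // ler_pdivlMr // => ? ?.
rewrite ler_norml; apply/andP; split; lra.
Qed.

Lemma grid_floor_step (R : realType) (d : nat) (h s : R) (j : 'I_d)
    (x : 'rV[R]_d) :
  0 < h -> 0 <= s -> exists2 m : nat, `|m%:R * h - s| <= h &
    grid_floor h (x + s *: 'e_j) = grid_floor h x + (m%:R * h) *: 'e_j.
Proof.
move=> h0 s0.
set a := Num.floor (x 0 j / h); set b := Num.floor ((x 0 j + s) / h).
have ab : a <= b by apply: le_floor; rewrite ?ler_pM2r ?invr_gt0 ?lerDl.
have [m mE] : exists m : nat, b - a = m%:Z.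
  by exists `|b - a|%N; rewrite gez0_abs // subr_ge0.
have mE' : b%:~R = a%:~R + m%:R :> R.
  by rewrite pmulrn -mE intrB; ring.
exists m.
  have := floor_le (x 0 j / h); have := floorD1_gt (x 0 j / h).
  have := floor_le ((x 0 j + s) / h); have := floorD1_gt ((x 0 j + s) / h).
  rewrite -/a -/b !intrD !ltr_pdivrMr // !ler_pdivlMr // mE' => ? ? ? ?.
  rewrite ler_norml; apply/andP; split; lra.
apply/rowP => i; rewrite !mxE; have [->|ij] := eqVneq i j; last first.
  by rewrite andbF /= !mulr0 !addr0.
by rewrite eqxx /= !mulr1 -/a -/b mE'; ring.
Qed.

Lemma fdiff_steps (R : realType) (d : nat) (h rho C : R) (j : 'I_d)
    (F : 'rV[R]_d -> R) (c y : 'rV[R]_d) (m : nat) :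
  0 < h -> `|y - c| + m%:R * h <= rho ->
  (forall x, `|x - c| <= rho -> `|fdiff h j F x| <= C) ->
  `|F (y + (m%:R * h) *: 'e_j) - F y| <= C * (m%:R * h).
Proof.
move=> h0 yr FC.
elim: m yr => [|m IH] yr.
  by rewrite !mul0r scale0r addr0 subrr normr0 mulr0.
move: yr; rewrite -natr1 => yr.
have /IH {}IH : `|y - c| + m%:R * h <= rho by nra.
have := FC (y + (m%:R * h) *: 'e_j).
have -> : y + ((m%:R + 1) * h) *: 'e_j = y + (m%:R * h) *: 'e_j + h *: 'e_j.
  by rewrite mulrDl mul1r scalerDl addrA.
have inQ : `|y + (m%:R * h) *: 'e_j - c| <= rho.
  rewrite addrAC; apply: le_trans (ler_normD _ _) _.
  have := norm_scale_unit (m%:R * h) j.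
  by rewrite ger0_norm ?mulr_ge0 ?(ltW h0) //; nra.
move=> /(_ inQ); rewrite /fdiff normrM gtr0_norm ?invr_gt0 // ler_pdivrMl //.
move: IH; rewrite !ler_norml => /andP[? ?] /andP[? ?].
by apply/andP; split; lra.
Qed.

(** A discrete Taylor formula: after [m] steps the slope has moved by at most [C m h], and these
    errors add up along the path. *)
Lemma fdiff_steps2 (R : realType) (d : nat) (h rho C : R) (j : 'I_d)
    (F : 'rV[R]_d -> R) (c y : 'rV[R]_d) (m : nat) :
  0 < h -> `|y - c| + m%:R * h <= rho -> 0 <= C ->
  (forall x, `|x - c| <= rho -> `|fdiff h j (fdiff h j F) x| <= C) ->
  `|F (y + (m%:R * h) *: 'e_j) - F y - m%:R * h * fdiff h j F y| <=
    C * (m%:R * h) ^+ 2.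
Proof.
move=> h0 yr C0 FC.
elim: m yr => [|m IH] yr.
  by rewrite !mul0r scale0r addr0 subrr subrr normr0 expr0n mulr0.
have yr' : `|y - c| + m%:R * h <= rho by move: yr; rewrite -natr1; nra.
have {}IH := IH yr'.
have := fdiff_steps h0 yr' FC.
have -> : y + (m.+1%:R * h) *: 'e_j = y + (m%:R * h) *: 'e_j + h *: 'e_j.
  by rewrite -natr1 mulrDl mul1r scalerDl addrA.
set z := y + (m%:R * h) *: 'e_j in IH *.
rewrite -natr1; set v := fdiff h j F y in IH *.
have -> : F (z + h *: 'e_j) = F z + h * fdiff h j F z.
  by rewrite /fdiff mulrA divff ?gt_eqF // mul1r [RHS]addrC subrK.
set v' := fdiff h j F z => H.
have H1 : `|h * (v' - v)| <= C * (m%:R * h) * h.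
  by rewrite normrM gtr0_norm // mulrC ler_wpM2r // ltW.
have -> : F z + h * v' - F y - (m%:R + 1) * h * v =
   (F z - F y - m%:R * h * v) + h * (v' - v) by ring.
apply: le_trans (ler_normD _ _) _; apply: le_trans (lerD IH H1) _.
have m0 : 0 <= m%:R :> R by [].
have -> : C * ((m%:R + 1) * h) ^+ 2 =
   C * (m%:R * h) ^+ 2 + C * (m%:R * h) * h + C * (m%:R + 1) * h ^+ 2 by ring.
by rewrite lerDl mulr_ge0 ?sqr_ge0 // mulr_ge0 //; lra.
Qed.

(** * Limits of discrete harmonic functions *)

Lemma near_small (R : realType) (U : set_system R) (a : R) :
  ProperFilter U -> 0^'+ `<=` U -> 0 < a -> \forall h \near U, 0 < h < a.
Proof.
move=> PU hU a0; apply: hU; near=> h; apply/andP; split.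
  by near: h; exact: nbhs_right_gt.
by near: h; exact: nbhs_right_lt.
Unshelve. all: by end_near. Qed.

Definition grid_lim (R : realType) (d : nat) (U : set_system R)
    (F : R -> 'rV[R]_d -> R) (x : 'rV[R]_d) : R :=
  lim ((fun h => F h (grid_floor h x)) @ U).

Lemma grid_lim_cvg (R : realType) (d : nat) (U : set_system R)
    (F : R -> 'rV[R]_d -> R) (c : 'rV[R]_d) (rho C : R) :
  UltraFilter U -> 0^'+ `<=` U -> 0 < rho ->
  (\forall h \near U, forall x, `|x - c| <= rho -> `|F h x| <= C) ->
  forall x, `|x - c| <= 3 / 4 * rho ->
  (fun h => F h (grid_floor h x)) @ U --> grid_lim U F x.
Proof.
move=> UU hU r0 FC x xc; apply: (@ultra_bounded_cvg _ _ _ _ C).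
have r1 : 0 < rho / 4 by lra.
apply: filterS2 FC (near_small _ hU r1) => h FC /andP[h0 hr]; apply: FC.
have := grid_floor_le x h0; have := ler_normD (grid_floor h x - x) (x - c).
by rewrite addrA subrK; lra.
Qed.

Lemma ball_step (R : realType) (d : nat) (x c : 'rV[R]_d) (s : R) j :
  `|x + s *: 'e_j - c| <= `|x - c| + `|s|.
Proof.
rewrite addrAC; apply: le_trans (ler_normD _ _) _.
by rewrite lerD2l norm_scale_unit.
Qed.

Lemma grid_lim_lip_pos (R : realType) (d : nat) (U : set_system R)
    (F : R -> 'rV[R]_d -> R) (c : 'rV[R]_d) (j : 'I_d) (rho C : R) :
  UltraFilter U -> 0^'+ `<=` U -> 0 < rho -> 0 <= C ->
  (\forall h \near U, forall x, `|x - c| <= rho ->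
     `|F h x| <= C /\ `|fdiff h j (F h) x| <= C) ->
  forall x s, `|x - c| <= rho / 2 -> 0 <= s <= rho / 4 ->
  `|grid_lim U F (x + s *: 'e_j) - grid_lim U F x| <= C * s.
Proof.
move=> UU hU r0 C0 FC x s xc /andP[s0 sr].
have FC1 : \forall h \near U, forall x, `|x - c| <= rho -> `|F h x| <= C.
  by apply: filterS FC => h H y /H [].
have xs := ball_step x c s j; rewrite ger0_norm // in xs.
have c1 : (fun h => F h (grid_floor h x)) @ U --> grid_lim U F x.
  by apply: grid_lim_cvg FC1 _ _ => //; lra.
have c2 : (fun h => F h (grid_floor h (x + s *: 'e_j))) @ U -->
    grid_lim U F (x + s *: 'e_j).
  by apply: grid_lim_cvg FC1 _ _ => //; lra.
have c3 : (fun h => F h (grid_floor h (x + s *: 'e_j)) - F h (grid_floor h x)) @ U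
    --> grid_lim U F (x + s *: 'e_j) - grid_lim U F x by exact: cvgB.
apply: (cvg_norm_le (K := C) _ hU c3).
have r1 : 0 < rho / 8 by lra.
apply: filterS2 FC (near_small _ hU r1) => h FC /andP[h0 hr] /=.
have [m] := grid_floor_step j x h0 s0.
rewrite ler_norml => /andP[ms1 ms2] ->.
apply: le_trans (@fdiff_steps _ _ h rho C j (F h) c _ m h0 _ _) _.
- have := grid_floor_le x h0; have := ler_normD (grid_floor h x - x) (x - c).
  by rewrite addrA subrK; lra.
- by move=> y /FC [].
by rewrite -mulrDr ler_wpM2l //; lra.
Qed.

(** A negative step is a positive one from the other endpoint, at the price of a smaller ball. *)
Lemma grid_lim_lip (R : realType) (d : nat) (U : set_system R)
    (F : R -> 'rV[R]_d -> R) (c : 'rV[R]_d) (j : 'I_d) (rho C : R) :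
  UltraFilter U -> 0^'+ `<=` U -> 0 < rho -> 0 <= C ->
  (\forall h \near U, forall x, `|x - c| <= rho ->
     `|F h x| <= C /\ `|fdiff h j (F h) x| <= C) ->
  forall x s, `|x - c| <= rho / 4 -> `|s| <= rho / 4 ->
  `|grid_lim U F (x + s *: 'e_j) - grid_lim U F x| <= C * `|s|.
Proof.
move=> UU hU r0 C0 FC x s xc sr.
have H := grid_lim_lip_pos UU hU r0 C0 FC.
have [s0|s0] := leP 0 s.
  rewrite ger0_norm // in sr *; apply: H; first lra.
  by rewrite s0.
rewrite ltr0_norm // in sr *.
have := H (x + s *: 'e_j) (- s).
rewrite scaleNr addrK [`|grid_lim _ _ _ - _|]distrC; apply.
  by have := ball_step x c s j; rewrite ltr0_norm //; lra.
by apply/andP; split; lra.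
Qed.

(** The discrete Taylor formula survives the limit and identifies the limit of the quotients as a
    derivative. The factor 2 comes from [s < 0]: the expansion is then based at [x + s e_j], and
    moving its slope back to [x] costs another [C s^2]. *)
Lemma grid_lim_quad (R : realType) (d : nat) (U : set_system R)
    (F : R -> 'rV[R]_d -> R) (c : 'rV[R]_d) (j : 'I_d) (rho C : R) :
  UltraFilter U -> 0^'+ `<=` U -> 0 < rho -> 0 <= C ->
  (\forall h \near U, forall x, `|x - c| <= rho ->
     [/\ `|F h x| <= C, `|fdiff h j (F h) x| <= C &
         `|fdiff h j (fdiff h j (F h)) x| <= C]) ->
  forall x s, `|x - c| <= rho / 4 -> `|s| <= rho / 4 ->
  `|grid_lim U F (x + s *: 'e_j) - grid_lim U F x -
     s * grid_lim U (fun h => fdiff h j (F h)) x| <= 2 * C * s ^+ 2.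
Proof.
move=> UU hU r0 C0 FC.
have FC1 : \forall h \near U, forall x, `|x - c| <= rho -> `|F h x| <= C.
  by apply: filterS FC => h H y /H [].
have FC2 : \forall h \near U, forall x, `|x - c| <= rho ->
    `|fdiff h j (F h) x| <= C.
  by apply: filterS FC => h H y /H [].
have FC3 : \forall h \near U, forall x, `|x - c| <= rho ->
    `|fdiff h j (F h) x| <= C /\ `|fdiff h j (fdiff h j (F h)) x| <= C.
  by apply: filterS FC => h H y /H [].
set W := grid_lim U F; set V := grid_lim U _.
have pos x s : `|x - c| <= rho / 2 -> 0 <= s <= rho / 4 ->
    `|W (x + s *: 'e_j) - W x - s * V x| <= C * s ^+ 2.
  move=> xc /andP[s0 sr].
  have xs := ball_step x c s j; rewrite ger0_norm // in xs.
  have c1 : (fun h => F h (grid_floor h x)) @ U --> W x.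
    by apply: grid_lim_cvg FC1 _ _ => //; lra.
  have c2 : (fun h => F h (grid_floor h (x + s *: 'e_j))) @ U -->
      W (x + s *: 'e_j).
    by apply: grid_lim_cvg FC1 _ _ => //; lra.
  have c3 : (fun h => fdiff h j (F h) (grid_floor h x)) @ U --> V x.
    by apply: (grid_lim_cvg (F := fun h => fdiff h j (F h))) FC2 _ _ => //; lra.
  have c4 : (fun h => s * fdiff h j (F h) (grid_floor h x)) @ U --> s * V x.
    by apply: cvgM => //; exact: cvg_cst.
  have c5 : (fun h => F h (grid_floor h (x + s *: 'e_j)) - F h (grid_floor h x) -
      s * fdiff h j (F h) (grid_floor h x)) @ U -->
      W (x + s *: 'e_j) - W x - s * V x by apply: cvgB => //; exact: cvgB.
  (* [K] collects the cost of replacing [m h] by [s]: [(m h)^2 <= s^2 + (2 s + 1) h] for [h <= 1],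
     and the linear term changes by at most [C h]. *)
  apply: (cvg_norm_le (K := C * (2 * s + 1) + C) _ hU c5).
  have r1 : 0 < Num.min 1 (rho / 8) by rewrite lt_min ltr01 /=; lra.
  apply: filterS2 FC (near_small _ hU r1) => h FC /andP[h0].
  rewrite lt_min => /andP[h1 hr] /=.
  have [m] := grid_floor_step j x h0 s0.
  rewrite ler_norml => /andP[ms1 ms2] ->.
  set y := grid_floor h x.
  have yr : `|y - c| + m%:R * h <= rho.
    have := grid_floor_le x h0; have := ler_normD (grid_floor h x - x) (x - c).
    by rewrite addrA subrK -/y; lra.
  have mh0 : 0 <= m%:R * h by rewrite mulr_ge0 // ltW.
  have A := fdiff_steps2 h0 yr C0 (fun z zr => let: And3 _ _ H := FC z zr in H).
  have B : `|(m%:R * h - s) * fdiff h j (F h) y| <= h * C.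
    rewrite normrM ler_pM //; first by rewrite ler_norml; apply/andP; split; lra.
    by have [] := FC y _; lra.
  have -> : F h (y + (m%:R * h) *: 'e_j) - F h y - s * fdiff h j (F h) y =
    (F h (y + (m%:R * h) *: 'e_j) - F h y - m%:R * h * fdiff h j (F h) y) +
    (m%:R * h - s) * fdiff h j (F h) y by ring.
  apply: le_trans (ler_normD _ _) _; apply: le_trans (lerD A B) _.
  have : (m%:R * h) ^+ 2 <= s ^+ 2 + (2 * s + 1) * h.
    have : (m%:R * h) ^+ 2 <= (s + h) ^+ 2 by rewrite ler_pXn2r ?nnegrE //; lra.
    nra.
  move=> /(ler_wpM2l C0); rewrite mulrDr; lra.
move=> x s xc sr; have [s0|s0] := leP 0 s.
  rewrite ger0_norm // in sr; apply: le_trans (pos x s _ _) _; [lra| by rewrite s0|].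
  by rewrite ler_wpM2r ?sqr_ge0 //; lra.
have L := grid_lim_lip (F := fun h => fdiff h j (F h)) UU hU r0 C0 FC3 xc sr.
rewrite -/V (ltr0_norm s0) in L.
rewrite ltr0_norm // in sr.
have := pos (x + s *: 'e_j) (- s); rewrite scaleNr addrK sqrrN => P.
have {}P : `|W x - W (x + s *: 'e_j) - - s * V (x + s *: 'e_j)| <= C * s ^+ 2.
  apply: P; last by apply/andP; split; lra.
  by have := ball_step x c s j; rewrite ltr0_norm //; lra.
have -> : W (x + s *: 'e_j) - W x - s * V x =
  - (W x - W (x + s *: 'e_j) - - s * V (x + s *: 'e_j)) +
    s * (V (x + s *: 'e_j) - V x) by ring.
apply: le_trans (ler_normD _ _) _; rewrite normrN normrM (ltr0_norm s0).
have : - s * `|V (x + s *: 'e_j) - V x| <= - s * (C * - s).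
  by rewrite ler_wpM2l //; lra.
lra.
Qed.

(** The path from [c] to [y] changes one coordinate at a time. In the max-norm its vertices [z m]
    never leave the ball of radius [|y - c|]. *)
Lemma coordinatewise_lipschitz_continuous (R : realType) (d : nat)
    (W : 'rV[R]_d -> R) (c : 'rV[R]_d) (rho C : R) :
  0 < rho -> 0 <= C ->
  (forall x s j, `|x - c| <= rho -> `|s| <= rho ->
     `|W (x + s *: 'e_j) - W x| <= C * `|s|) ->
  {for c, continuous W}.
Proof.
move=> r0 C0 WL.
have L y : `|y - c| <= rho -> `|W c - W y| <= C * d%:R * `|y - c|.
  move=> yc.
  pose z (m : nat) : 'rV[R]_d := \row_i (if (i < m)%N then y 0 i else c 0 i).
  have zE (m : 'I_d) : z m.+1 = z m + (y 0 m - c 0 m) *: 'e_m.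
    apply/rowP => i; rewrite !mxE ltnS leq_eqVlt.
    have [->|im] := eqVneq i m; first by rewrite eqxx ltnn /=; ring.
    have /negbTE -> : i != m :> nat by rewrite val_eqE.
    by rewrite andbF mulr0 addr0.
  have zc m : `|z m - c| <= rho.
    apply: rV_norm_le => [|i]; first exact: ltW.
    rewrite !mxE; case: ifP => _; last by rewrite subrr normr0 ltW.
    by apply: le_trans yc; have := rV_coord_le_norm (y - c) i; rewrite !mxE.
  have z0 : z 0%N = c by apply/rowP => i; rewrite mxE.
  have zd : z d = y by apply/rowP => i; rewrite mxE ltn_ord.
  rewrite -{1}z0 -{1}zd distrC -(telescope_sumr (fun m => W (z m))) //.
  rewrite big_mkord; apply: le_trans (ler_norm_sum _ _ _) _.
  apply: le_trans (_ : \sum_(i < d) C * `|y - c| <= _).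
    apply: ler_sum => m _; rewrite zE.
    have ym := rV_coord_le_norm (y - c) m; rewrite !mxE in ym.
    apply: le_trans (WL _ _ _ (zc m) _) _; first exact: le_trans ym yc.
    by rewrite ler_wpM2l.
  by rewrite sumr_const card_ord -[_ * _ *+ _]mulr_natr mulrAC.
apply/(@cvgrPdist_le _ _ _ _ (nbhs_filter c)) => e e0.
have e1 : 0 < Num.min rho (e / (C * d%:R + 1)).
  by rewrite lt_min r0 divr_gt0 // ltr_wpDl // mulr_ge0.
have : \forall y \near c, `|c - y| < Num.min rho (e / (C * d%:R + 1)).
  by apply/nbhs_ballP; eexists; [exact: e1|move=> y; rewrite -ball_normE].
apply: filterS => y /ltW; rewrite distrC le_min => /andP[yr ye].
apply: le_trans (L y yr) _.
have k0 : 0 <= C * d%:R by rewrite mulr_ge0.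
move: ye; rewrite ler_pdivlMr ?ltr_wpDl //; have := normr_ge0 (y - c); nra.
Qed.

(* Laplacians of the second differences are evaluated at neighbouring grid
   points, whence the bound on third differences. *)
Lemma grid_lim_harmonic (R : realType) (d : nat) (U : set_system R)
    (f : R -> 'rV[R]_d -> R) (r M : R) (c : 'rV[R]_d) :
  UltraFilter U -> 0^'+ `<=` U -> 0 < r -> 0 < M ->
  (\forall h \near U, forall x, `|x - c| <= r ->
     `|f h x| <= M /\ dlap h (f h) x = 0) ->
  let W := grid_lim U f in
  let G i := grid_lim U (fun h => fdiff h i (f h)) in
  let H i j := grid_lim U (fun h => fdiff h j (fdiff h i (f h))) in
  [/\ {for c, continuous W},
      forall i, is_derive c 'e_i W (G i c) /\ {for c, continuous (G i)},
      forall i j, is_derive c 'e_j (G i) (H i j c) /\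
                  {for c, continuous (H i j)} &
      \sum_(i < d) H i i c = 0].
Proof.
move=> UU hU r0 M0 fM.
have [C HC] := @fdiff3_le R d r M r0 M0.
have r16 : 0 < r / 16 by lra.
have B : \forall h \near U, forall x, `|x - c| <= r / 8 ->
  [/\ `|f h x| <= C, forall i, `|fdiff h i (f h) x| <= C,
      forall i j, `|fdiff h j (fdiff h i (f h)) x| <= C &
      forall i j l, `|fdiff h l (fdiff h j (fdiff h i (f h))) x| <= C].
  apply: filterS2 fM (near_small _ hU r16) => h fM /andP[h0 hr].
  apply: HC => //; first lra.
    by move=> x /fM [].
  by move=> x /fM [].
have C0 : 0 <= C.
  have /filter_ex [h] := B; move=> /(_ c); rewrite subrr normr0 => -[|+ _ _ _].
    by lra.
  exact: le_trans.
have r8 : 0 < r / 8 by lra.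
have cc (q : R) : 0 < q -> `|c - c| <= q by move=> /ltW; rewrite subrr normr0.
have q0 : 0 < r / 8 / 4 by lra.
move=> W G H.
have dW i : is_derive c 'e_i W (G i c).
  apply: (is_derive_quad (r := r / 8 / 4) (C := 2 * C)) => // s sr.
  apply: grid_lim_quad r8 C0 _ _ _ (cc _ q0) (ltW sr) => //.
  by apply: filterS B => h Bh x /Bh [].
have dG i j : is_derive c 'e_j (G i) (H i j c).
  apply: (is_derive_quad (r := r / 8 / 4) (C := 2 * C)) => // s sr.
  apply: (grid_lim_quad (F := fun h => fdiff h i (f h))) r8 C0 _ _ _ (cc _ q0) (ltW sr) => //.
  by apply: filterS B => h Bh x /Bh [].
have cW : {for c, continuous W}.
  apply: (coordinatewise_lipschitz_continuous q0 C0) => x s j xc sc.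
  apply: grid_lim_lip r8 C0 _ _ _ xc sc => //.
  by apply: filterS B => h Bh y /Bh [].
have cG i : {for c, continuous (G i)}.
  apply: (coordinatewise_lipschitz_continuous q0 C0) => x s j xc sc.
  apply: (grid_lim_lip (F := fun h => fdiff h i (f h))) r8 C0 _ _ _ xc sc => //.
  by apply: filterS B => h Bh y /Bh [].
have cH i j : {for c, continuous (H i j)}.
  apply: (coordinatewise_lipschitz_continuous q0 C0) => x s l xc sc.
  apply: (grid_lim_lip (F := fun h => fdiff h j (fdiff h i (f h)))) r8 C0 _ _ _ xc sc => //.
  by apply: filterS B => h Bh y /Bh [].
split=> //.
have cvH i : (fun h => fdiff h i (fdiff h i (f h)) (grid_floor h c)) @ U --> H i i c.
  apply: (grid_lim_cvg (F := fun h => fdiff h i (fdiff h i (f h))) (c := c) (C := C)) r8 _ _ _ => //.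
    by apply: filterS B => h Bh x /Bh [].
  by apply: cc; lra.
have cvS : (fun h => \sum_(i < d) fdiff h i (fdiff h i (f h)) (grid_floor h c)) @ U -->
    \sum_(i < d) H i i c.
  by apply: cvg_big => [|i _]; [exact: add_continuous|exact: cvH].
apply/eqP; rewrite -normr_le0.
apply: (cvg_norm_le (K := d%:R * C) _ hU cvS).
have r32 : 0 < r / 32 by lra.
apply: filterS3 fM B (near_small _ hU r32) => h fM Bh /andP[h0 hr].
set y := grid_floor h c.
have yc : `|y - c| <= h by exact: grid_floor_le.
have ey (i : 'I_d) : `|y - h *: 'e_i - c| <= r / 8.
  by rewrite -scaleNr; have := ball_step y c (- h) i; rewrite normrN gtr0_norm //; lra.
(* Two forward differences based at [y - h e_i] form the centred second difference at [y]. *)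
have E : \sum_(i < d) fdiff h i (fdiff h i (f h)) (y - h *: 'e_i) = 0.
  have yr : `|y - c| <= r by lra.
  have [_ L0] := fM y yr.
  transitivity (h^-1 * h^-1 * dlap h (f h) y); last by rewrite L0 mulr0.
  rewrite /dlap mulr_sumr; apply: eq_bigr => i _.
  by rewrite /fdiff subrK; ring.
rewrite (_ : \sum_(i < d) _ = \sum_(i < d) (fdiff h i (fdiff h i (f h)) y -
  fdiff h i (fdiff h i (f h)) (y - h *: 'e_i))); last by rewrite sumrB E subr0.
rewrite add0r; apply: le_trans (ler_norm_sum _ _ _) _.
apply: le_trans (_ : \sum_(i < d) C * h <= _); last first.
  by rewrite sumr_const card_ord -[_ * _ *+ _]mulr_natl mulrA.
apply: ler_sum => i _.
have [_ _ _ /(_ i i i)] := Bh _ (ey i).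
by rewrite {1}/fdiff subrK normrM gtr0_norm ?invr_gt0 // ler_pdivrMl // mulrC.
Qed.

(** * Limits of discrete superharmonic functions *)

Lemma compact_ball (R : realType) (d : nat) (c : 'rV[R]_d) (r : R) :
  0 < r -> compact [set x : 'rV[R]_d | `|x - c| <= r].
Proof.
move=> r0; apply: bounded_closed_compact.
  exists (`|c| + r); split; first exact: num_real.
  move=> M rM x /= xc; apply: ltW; apply: le_lt_trans rM.
  by have := ler_normD (x - c) c; rewrite subrK; lra.
have -> : [set x : 'rV[R]_d | `|x - c| <= r] = closed_ball c r.
  by rewrite closed_ballE //; apply/seteqP; split=> x /=; rewrite /closed_ball_ /= distrC.
exact: closed_ball_closed.
Qed.

Lemma near_cball (R : realType) (d : nat) (c : 'rV[R]_d) (P : set 'rV[R]_d) :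
  (\forall x \near c, P x) ->
  exists2 r : R, 0 < r & forall x, `|x - c| <= r -> P x.
Proof.
move=> /nbhs_ballP [e e0 eP]; exists (e / 2); first by rewrite divr_gt0.
move=> x xc; apply: eP; rewrite -ball_normE /ball_ /= distrC.
by rewrite /= in e0; lra.
Qed.

Lemma ball_near (R : realType) (d : nat) (c : 'rV[R]_d) (r : R) :
  0 < r -> \forall x \near c, `|x - c| < r.
Proof.
move=> r0; apply/nbhs_ballP; exists r => // x.
by rewrite -ball_normE /ball_ /= distrC.
Qed.

Lemma is_derive_line (R : realType) (V : normedModType R) (f : V -> R)
    (x v : V) (t l : R) :
  is_derive (x + t *: v) v f l -> is_derive t 1 (fun s => f (x + s *: v)) l.
Proof.
have E : (fun h => h^-1 *: (((fun s => f (x + s *: v)) \o shift t) (h *: 1) -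
    f (x + t *: v))) = (fun h => h^-1 *: ((f \o shift (x + t *: v)) (h *: v) -
    f (x + t *: v))).
  apply/funext => h /=; congr (_ *: (f _ - _)).
  by rewrite [h *: 1]mulr1 scalerDl addrCA.
by move=> [df <-]; split; rewrite /derivable /derive E.
Qed.

(** The mean value theorem is applied twice: to [g1] on [[-t, t]], which shows that
    [k t = g t + g (- t) - m t^2] has a nonnegative derivative, and then to [k] on [[0, s]]. *)
Lemma second_difference_ge (R : realType) (g g1 g2 : R -> R) (s m : R) :
  0 < s ->
  (forall t : R, `|t| <= s -> is_derive t 1 g (g1 t)) ->
  (forall t : R, `|t| <= s -> is_derive t 1 g1 (g2 t)) ->
  (forall t, `|t| <= s -> m <= g2 t) ->
  m * s ^+ 2 <= g s + g (- s) - 2 * g 0.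
Proof.
move=> s0 D1 D2 m2.
have Dc (f f' : R -> R) (t : R) : is_derive t 1 f (f' t) -> {for t, continuous f}.
  by move=> D; apply: differentiable_continuous; apply/derivable1_diffP; case: D.
have g1ge (t : R) : 0 < t < s -> 0 <= g1 t - g1 (- t) - 2 * m * t.
  move=> /andP[t0 ts]; have tt : - t < t by lra.
  have inI u : - t <= u <= t -> `|u| <= s.
    by move=> /andP[? ?]; rewrite ler_norml; apply/andP; split; lra.
  have [||u] := @MVT _ g1 g2 (- t) t tt.
  - move=> u; rewrite in_itv /= => /andP[? ?]; apply: D2; apply: inI.
    by apply/andP; split; exact: ltW.
  - apply: continuous_in_subspaceT => u; rewrite inE /= in_itv /= => /inI us.
    exact: Dc (D2 u us).
  rewrite in_itv /= => /andP[ut1 ut2] ->.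
  have /m2 : `|u| <= s by apply: inI; apply/andP; split; exact: ltW.
  by move: (g2 u) => q; nra.
pose k t := g t + g (- t) - m * t ^+ 2.
have Dk (t : R) : `|t| <= s -> is_derive t 1 k (g1 t - g1 (- t) - 2 * m * t).
  move=> ts; have E1 := D1 t ts.
  have E2 : is_derive (- t) 1 g (g1 (- t)) by apply: D1; rewrite normrN.
  have E3 : is_derive t 1 (g \o -%R) (g1 (- t) * - 1) by apply: is_derive1_comp.
  have E4 : is_derive t 1 (fun u : R => m * u ^+ 2) (2 * m * t).
    apply: is_derive_eq; rewrite /GRing.scale /=; ring.
  apply: is_derive_eq (is_deriveB (is_deriveD E1 E3) E4) _; ring.
have [||u] := @MVT _ k (fun t => g1 t - g1 (- t) - 2 * m * t) 0 s s0.
- move=> u; rewrite in_itv /= => /andP[? ?]; apply: Dk.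
  by rewrite gtr0_norm // ltW.
- apply: continuous_in_subspaceT => u; rewrite inE /= in_itv /= => /andP[u0 us].
  have us' : `|u| <= s by rewrite ger0_norm.
  exact: (Dc k (fun t => g1 t - g1 (- t) - 2 * m * t) u (Dk u us')).
rewrite in_itv /= => us; have /g1ge := us; rewrite /k oppr0.
move: (g1 u - _ - _) => q q0; rewrite expr0n mulr0 !subr0 => E.
have : 0 <= q * s by rewrite mulr_ge0 // ltW.
lra.
Qed.

(* Locally uniform limits, along [U], of equi-Lipschitz functions that are
   superharmonic for the discrete Laplacian of step [s h -> 0]. *)
Definition superharmonic_limit (R : realType) (d : nat) (U : set_system R)
    (w : 'rV[R]_d -> R) : Prop :=
  exists (f : R -> 'rV[R]_d -> R) (s : R -> R) (L : R),
  [/\ 0 <= L,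
      \forall h \near U, [/\ 0 < s h, forall x y, `|f h x - f h y| <= L * `|x - y|
                           & forall x, dlap (s h) (f h) x <= 0],
      s @ U --> 0 & forall x, f ^~ x @ U --> w x].

Lemma superharmonic_limit_lipschitz (R : realType) (d : nat) (U : set_system R)
    (w : 'rV[R]_d -> R) :
  UltraFilter U -> superharmonic_limit U w ->
  exists2 L, 0 <= L & forall x y, `|w x - w y| <= L * `|x - y|.
Proof.
move=> UU [f [s [L [L0 fL _ fw]]]]; exists L => // x y.
have cv : (fun h => `|f h x - f h y|) @ U --> `|w x - w y|.
  by apply: cvg_norm; apply: cvgB.
apply: (ler_cvg_to cv (cvg_cst (L * `|x - y|))).
by apply: filterS fL => h [].
Qed.

Lemma lipschitz_continuous (R : realType) (d : nat) (w : 'rV[R]_d -> R) L x :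
  (forall y, `|w x - w y| <= L * `|x - y|) -> {for x, continuous w}.
Proof.
move=> wL; apply/(@cvgrPdist_le _ _ _ _ (nbhs_filter x)) => e e0.
have k0 : 0 < `|L| + 1 by rewrite ltr_wpDl.
have : \forall y \near x, `|y - x| < e / (`|L| + 1).
  by apply: ball_near; rewrite divr_gt0.
apply: filterS => y; rewrite ltr_pdivlMr // => yx; apply: le_trans (wL y) _.
have := normr_ge0 (y - x); have := ler_norm L; rewrite [`|x - y|]distrC; nra.
Qed.

(** Dilating by [t] turns step [s h] into [t * s h]; this is why the class allows steps other than
    [h] itself. *)
Lemma superharmonic_limit_affine (R : realType) (d : nat) (U : set_system R)
    (w : 'rV[R]_d -> R) (a b t : R) :
  UltraFilter U -> 0 <= a -> 0 < t -> superharmonic_limit U w ->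
  superharmonic_limit U (fun x => a * w (t^-1 *: x) + b).
Proof.
move=> UU a0 t0 [f [s [L [L0 fL sU fw]]]].
exists (fun h x => a * f h (t^-1 *: x) + b), (fun h => t * s h), (a * L * t^-1).
have tV : 0 < t^-1 by rewrite invr_gt0.
split.
- by rewrite !mulr_ge0 // ltW.
- apply: filterS fL => h [s0 fL fS]; split=> [|x y|x].
  + by rewrite mulr_gt0.
  + rewrite (_ : _ - _ = a * (f h (t^-1 *: x) - f h (t^-1 *: y))); last by ring.
    rewrite normrM (ger0_norm a0) -!mulrA ler_wpM2l //.
    apply: le_trans (fL _ _) _.
    by rewrite -scalerBr normrZ gtr0_norm.
  + rewrite dlapD dlap_cst addr0 dlapZ mulr_ge0_le0 //.
    apply: le_trans (fS (t^-1 *: x)); rewrite le_eqVlt; apply/orP; left.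
    apply/eqP; apply: eq_bigr => i _.
    by rewrite scalerDr scalerBr !scalerA mulrA mulVf ?gt_eqF // mul1r.
- by rewrite -(mulr0 t); apply: cvgM => //; exact: cvg_cst.
- move=> x; apply: cvgD; last exact: cvg_cst.
  by apply: cvgM; [exact: cvg_cst|exact: fw].
Qed.

Lemma dlap_sqr_dist (R : realType) (d : nat) (h : R) (c x : 'rV[R]_d) :
  dlap h (fun y => \sum_(j < d) (y 0 j - c 0 j) ^+ 2) x = 2 * d%:R * h ^+ 2.
Proof.
rewrite /dlap (eq_bigr (fun=> 2 * h ^+ 2)).
  by rewrite sumr_const card_ord -[_ * _ *+ _]mulr_natl; ring.
move=> j _; rewrite mulr_sumr -big_split -sumrB /= (bigD1 j) //=.
rewrite big1 ?addr0 => [|l lj]; rewrite !mxE ?eqxx ?(negbTE lj) /=; ring.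
Qed.

Lemma dlap_ge (R : realType) (d : nat) (A : set 'rV[R]_d) f g H
    (m : 'I_d -> R) (r s : R) (c x : 'rV[R]_d) :
  jet2_on A f g H -> (forall y, `|y - c| <= r -> A y) ->
  (forall y i, `|y - c| <= r -> m i <= H i i y) -> 0 < s ->
  `|x - c| + s <= r ->
  \sum_(i < d) m i * s ^+ 2 <= dlap s f x.
Proof.
move=> J rA mH s0 xr; apply: ler_sum => i _.
have inr t : `|t| <= s -> `|x + t *: 'e_i - c| <= r.
  by move=> ts; have := ball_step x c t i; lra.
have := @second_difference_ge R (fun t => f (x + t *: 'e_i))
  (fun t => g i (x + t *: 'e_i)) (fun t => H i i (x + t *: 'e_i)) s (m i) s0.
rewrite scale0r addr0 scaleNr; apply.
- move=> t /inr /rA Axt; apply: is_derive_line.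
  by have [_ /(_ i) [] ] := J _ Axt.
- move=> t /inr /rA Axt; apply: is_derive_line.
  by have [_ _ /(_ i i) [] ] := J _ Axt.
- by move=> t /inr; exact: mH.
Qed.

(* A test function touching [w] from below is made to touch strictly; its
   contact points with the discrete approximations then converge to [x0]. *)
Lemma superharmonic_limit_viscosity (R : realType) (d : nat)
    (U : set_system R) (w phi : 'rV[R]_d -> R) (A : set 'rV[R]_d) x0 :
  UltraFilter U -> superharmonic_limit U w ->
  open A -> A x0 -> C2_on A phi -> phi x0 = w x0 ->
  (\forall x \near x0, phi x <= w x) -> laplacian phi x0 <= 0.
Proof.
move=> UU slw oA Ax0 /C2_on_jet2 J phiw phile.
have [f [s [L [L0 fL sU fw]]]] := slw.
rewrite leNgt; apply/negP; set c := laplacian phi x0 => c0.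
set H := (fun i j => partial j (partial i phi)) in J.
have d0 : 0 < d.+1%:R :> R by [].
(* The oscillation of the Hessian costs [d eta <= c / 4] and the perturbation [del q] costs
   [2 d del = d eta / 2], so more than [c / 2] of the Laplacian is left. *)
pose eta := c / (4 * d.+1%:R).
have eta0 : 0 < eta by rewrite divr_gt0 // mulr_gt0.
have etaE : eta * d.+1%:R = c / 4 by rewrite /eta; field; rewrite gt_eqF.
pose m i := H i i x0 - eta.
have : \forall x \near x0, [/\ A x, phi x <= w x & forall i, m i <= H i i x].
  have N1 : nbhs x0 A by exact: open_nbhs_nbhs.
  have N2 : \forall x \near x0, forall i, m i <= H i i x.
    apply: (@filter_forall _ _ (fun i x => m i <= H i i x) _ (nbhs_filter x0)) => i; have [_ _ /(_ i i) [_ cH]] := J x0 Ax0.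
    have mi : m i < H i i x0 by rewrite /m; lra.
    exact: (@cvgr_ge _ _ _ (nbhs_filter x0) _ _ cH _ mi).
  by apply: filterS3 N1 phile N2 => x ? ? ?; split.
move=> /near_cball [r r0 rP].
pose del := eta / 4.
have del0 : 0 < del by rewrite divr_gt0.
pose q (x : 'rV[R]_d) := \sum_(j < d) (x 0 j - x0 0 j) ^+ 2.
pose psi x := phi x + (- del) * q x.
have rA y : `|y - x0| <= r -> A y by move=> /rP [].
have q0 x : 0 <= q x by apply: sumr_ge0 => i _; exact: sqr_ge0.
have qx0 : q x0 = 0 by rewrite /q big1 // => i _; rewrite subrr expr0n.
have cq x : {for x, continuous q}.
  have Jq := jet2_sum (fun j => jet2M
    (jet2D (@jet2_coord R d setT j) (@jet2_cst R d setT (- x0 0 j)))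
    (jet2D (@jet2_coord R d setT j) (@jet2_cst R d setT (- x0 0 j)))).
  by have [] := Jq x I.
have cpsi x : `|x - x0| <= r -> {for x, continuous psi}.
  move=> /rA Ax; have [cphi _ _] := J x Ax; apply: continuousD => //.
  by apply: continuousM; [exact: cst_continuous|exact: cq].
have lpsi x t : 0 < t -> `|x - x0| + t <= r -> c / 2 * t ^+ 2 <= dlap t psi x.
  move=> t0 xt; have := dlap_ge J rA (fun y i yr => let: And3 _ _ P := rP y yr in P i) t0 xt.
  rewrite /psi dlapD dlapZ dlap_sqr_dist -mulr_suml /m sumrB.
  rewrite -[\sum_(i < d) H i i x0]/c sumr_const card_ord -[eta *+ _]mulr_natl.
  have t2 : 0 < t ^+ 2 by rewrite exprn_gt0.
  move: etaE; rewrite -natr1 /del => etaE.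
  have : d%:R * eta <= c / 4 by lra.
  move=> D1 D2.
  have : (c / 4 - d%:R * eta) * t ^+ 2 >= 0 by rewrite mulr_ge0 ?ltW //; lra.
  have : 0 < c * t ^+ 2 by rewrite mulr_gt0.
  lra.
have ballN : [set x : 'rV[R]_d | `|x - x0| <= r] !=set0.
  by exists x0; rewrite /= subrr normr0 ltW.
(* [X h] maximizes [psi - f h] over the closed ball. The Lipschitz hypothesis stays inside the
   choice because it is known only for [U]-almost every [h]. *)
have [X XP] : {X : R -> 'rV[R]_d & forall h,
    (forall x y, `|f h x - f h y| <= L * `|x - y|) ->
    `|X h - x0| <= r /\ forall y, `|y - x0| <= r -> psi y - f h y <= psi (X h) - f h (X h)}.
  apply: (@choice R 'rV[R]_d (fun h X =>
    (forall x y, `|f h x - f h y| <= L * `|x - y|) ->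
    `|X - x0| <= r /\ forall y, `|y - x0| <= r -> psi y - f h y <= psi X - f h X)) => h.
  have [Lh|nL] := pselect (forall x y, `|f h x - f h y| <= L * `|x - y|); last first.
    by exists x0 => /nL.
  have [||y] := @EVT_max_rV R d (fun x => psi x - f h x) _ ballN.
  - exact: compact_ball.
  - apply: continuous_in_subspaceT => x; rewrite inE /= => xr.
    apply: continuousB; first exact: cpsi.
    exact: lipschitz_continuous (Lh x).
  rewrite inE /= => yr ymax; exists y => _; split=> // z zr.
  by apply: ymax; rewrite inE.
have UX : (X @ U) [set x | `|x - x0| <= r].
  by apply: filterS fL => h [_ /XP [] ].
have := @compact_ball _ _ x0 _ r0; rewrite compact_ultra => /(_ _ (ultra_fmap X UU) UX).
move=> [xs [xsr /= Xxs]].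
have cvf : (fun h => f h (X h)) @ U --> w xs.
  apply/cvgrPdist_le => e e0.
  have k0 : 0 < L + 1 by rewrite ltr_wpDl.
  have N1 : \forall h \near U, `|X h - xs| < e / 2 / (L + 1).
    by apply: (Xxs _ (@ball_near _ _ xs _ _)); rewrite !divr_gt0.
  have N2 : \forall h \near U, `|w xs - f h xs| <= e / 2.
    by apply: (cvgr_dist_le _ _ (fw xs)); rewrite divr_gt0.
  apply: filterS3 fL N1 N2 => h [_ fL' _].
  rewrite ltr_pdivlMr // => D1 D2.
  have := fL' xs (X h); rewrite distrC [`|xs - _|]distrC.
  have := ler_normD (w xs - f h xs) (f h xs - f h (X h)).
  rewrite addrA subrK [`|f h xs - _|]distrC.
  have := normr_ge0 (X h - xs); nra.
have cvp : (fun h => psi (X h)) @ U --> psi xs.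
  by apply: cvg_comp Xxs _; exact: cpsi.
have ge0 : psi x0 - w x0 <= psi xs - w xs.
  have c1 : (fun h => psi x0 - f h x0) @ U --> psi x0 - w x0.
    by apply: cvgB; [exact: cvg_cst|exact: fw].
  have c2 : (fun h => psi (X h) - f h (X h)) @ U --> psi xs - w xs.
    exact: cvgB.
  apply: (ler_cvg_to c1 c2); apply: filterS fL => h [_ /XP [_ mx] _].
  by apply: mx; rewrite subrr normr0 ltW.
(* The limit [xs] of the maximizers satisfies [psi xs - w xs >= 0], while [phi <= w] on the ball;
   the strict penalty [del q] therefore vanishes at [xs]. *)
have xs0 : xs = x0.
  have [_ le1 _] := rP xs xsr.
  move: ge0; rewrite {1}/psi qx0 mulr0 addr0 phiw subrr /psi => ge0.
  have : del * q xs <= 0 by lra.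
  rewrite pmulr_rle0 // => qle.
  have /eqP : q xs == 0 by rewrite eq_le qle q0.
  rewrite /q => /eqP; rewrite psumr_eq0 => [/allP qz|i _]; last exact: sqr_ge0.
  apply/rowP => i; have := qz i (mem_index_enum i).
  by rewrite /= sqrf_eq0 subr_eq0 => /eqP.
have r2 : 0 < r / 2 by rewrite divr_gt0.
have N1 : \forall h \near U, `|X h - x0| < r / 2.
  by rewrite xs0 in Xxs; apply: (Xxs _ (@ball_near _ _ x0 _ _)).
have N2 : \forall h \near U, s h < r / 2.
  by apply: (cvgr_lt _ sU).
have /filter_ex [h [[sh0 Lh Sh] Xh sh]] : \forall h \near U,
  [/\ [/\ 0 < s h, forall x y, `|f h x - f h y| <= L * `|x - y|
        & forall x, dlap (s h) (f h) x <= 0], `|X h - x0| < r / 2 & s h < r / 2].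
  by apply: filterS3 fL N1 N2 => h ? ? ?; split.
have [Xr mx] := XP h Lh.
have l2 : dlap (s h) (fun y => psi y - f h y) (X h) <= 0.
  apply: sumr_le0 => i _.
  have st t : `|t| = s h -> psi (X h + t *: 'e_i) - f h (X h + t *: 'e_i) <=
     psi (X h) - f h (X h).
    by move=> ts; apply: mx; have := ball_step (X h) x0 t i; rewrite ts; lra.
  have := st (s h); have := st (- s h); rewrite normrN gtr0_norm // scaleNr.
  move=> /(_ erefl) ? /(_ erefl) ?; lra.
rewrite dlapB in l2; have := Sh (X h).
have : 0 < c / 2 * s h ^+ 2 by rewrite mulr_gt0 ?divr_gt0 ?exprn_gt0.
have : c / 2 * s h ^+ 2 <= dlap (s h) psi (X h) by apply: lpsi => //; lra.
lra.
Qed.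

(** * Barrier and comparison *)

Definition sqnorm (R : realType) (d : nat) (x : 'rV[R]_d) : R :=
  \sum_(i < d) x 0 i ^+ 2.

(* [(16 + |x|^2)^-1] is strictly superharmonic in dimension [d >= 5]; the
   constant 16 leaves room for the discretization error of all steps [h <= 1]. *)
Definition barrier (R : realType) (d : nat) (x : 'rV[R]_d) : R :=
  (16 + sqnorm x)^-1.

Lemma sqnorm_ge0 (R : realType) (d : nat) (x : 'rV[R]_d) : 0 <= sqnorm x.
Proof. by apply: sumr_ge0 => i _; exact: sqr_ge0. Qed.

Lemma le_sqnorm (R : realType) (d : nat) (x : 'rV[R]_d) i :
  x 0 i ^+ 2 <= sqnorm x.
Proof.
rewrite /sqnorm (bigD1 i) //= lerDl.
by apply: sumr_ge0 => ? _; exact: sqr_ge0.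
Qed.

Lemma sqr_norm_le_sqnorm (R : realType) (d : nat) (x : 'rV[R]_d) :
  `|x| ^+ 2 <= sqnorm x.
Proof.
have h : `|x| <= Num.sqrt (sqnorm x).
  apply: rV_norm_le => [|i]; first exact: sqrtr_ge0.
  by rewrite -sqrtr_sqr ler_wsqrtr // le_sqnorm.
by rewrite -[leRHS]sqr_sqrtr ?sqnorm_ge0 // ler_pXn2r ?nnegrE.
Qed.

Lemma barrier_gt0 (R : realType) (d : nat) (x : 'rV[R]_d) : 0 < barrier x.
Proof. by rewrite invr_gt0 ltr_wpDr ?sqnorm_ge0. Qed.

Lemma barrier_le1 (R : realType) (d : nat) (x : 'rV[R]_d) : barrier x <= 1.
Proof. by rewrite invf_le1; have := sqnorm_ge0 x; lra. Qed.

Lemma jet2_sqnorm (R : realType) (d : nat) (A : set 'rV[R]_d) :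
  jet2_on A (@sqnorm R d) (fun i x => 2 * x 0 i) (fun i j _ => 2 * (j == i)%:R).
Proof.
have J := jet2_sum (fun k : 'I_d => jet2M (@jet2_coord R d A k) (@jet2_coord R d A k)).
apply: jet2_eq J => [x|i x|i j x].
- by apply: eq_bigr => k _; rewrite expr2.
- rewrite (bigD1 i) //= big1 ?addr0 => [|k /negbTE ki]; last by rewrite ki /=; ring.
  by rewrite eqxx /=; ring.
- rewrite (bigD1 i) //= big1 ?addr0 => [|k /negbTE ki]; last by rewrite ki /=; ring.
  by rewrite eqxx [i == j]eq_sym /=; ring.
Qed.

Lemma jet2_barrier (R : realType) (d : nat) (A : set 'rV[R]_d) :
  jet2_on A (@barrier R d)
    (fun i x => - (barrier x * barrier x * (2 * x 0 i)))
    (fun i j x => 2 * barrier x ^+ 3 * (2 * x 0 i) * (2 * x 0 j) -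
       barrier x ^+ 2 * (2 * (j == i)%:R)).
Proof.
have J := jet2D (@jet2_cst R d A 16) (@jet2_sqnorm R d A).
have Q0 x : A x -> 16 + sqnorm x != 0.
  by move=> _; rewrite gt_eqF // ltr_wpDr ?sqnorm_ge0.
by apply: jet2_eq (jet2_inv Q0 J) => [x|i x|i j x]; rewrite /barrier ?add0r.
Qed.

Lemma laplacian_barrier_lt0 (R : realType) (d : nat) (x : 'rV[R]_d) :
  (5 <= d)%N -> \sum_(i < d) (2 * barrier x ^+ 3 * (2 * x 0 i) * (2 * x 0 i) -
       barrier x ^+ 2 * (2 * (i == i)%:R)) < 0.
Proof.
move=> d5.
rewrite (eq_bigr (fun i => 8 * barrier x ^+ 3 * x 0 i ^+ 2 - 2 * barrier x ^+ 2)).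
  2: by move=> i _; rewrite eqxx /=; ring.
rewrite sumrB -mulr_sumr sumr_const card_ord -[_ * _ *+ _]mulr_natl.
rewrite -/(sqnorm x).
have b0 := barrier_gt0 x.
have bq : barrier x * sqnorm x <= 1.
  by rewrite /barrier mulrC ler_pdivrMr; have := sqnorm_ge0 x; lra.
have b2 : 0 < barrier x ^+ 2 by rewrite exprn_gt0.
have D : 5 <= d%:R :> R by rewrite ler_nat.
have -> : 8 * barrier x ^+ 3 * sqnorm x - d%:R * (2 * barrier x ^+ 2) =
  barrier x ^+ 2 * (8 * (barrier x * sqnorm x) - 2 * d%:R) by ring.
by rewrite pmulr_rlt0 //; lra.
Qed.

Lemma sqnorm_step (R : realType) (d : nat) (h : R) (i : 'I_d) (x : 'rV[R]_d) :
  sqnorm (x + h *: 'e_i) = sqnorm x + h ^+ 2 + 2 * h * x 0 i.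
Proof.
rewrite /sqnorm (bigD1 i) //= [in RHS](bigD1 i) //=.
rewrite (eq_bigr (fun j => x 0 j ^+ 2)) => [|j /negbTE ji]; last first.
  by rewrite !mxE ji /= mulr0 addr0.
by rewrite !mxE !eqxx /=; ring.
Qed.

(** With [S = 16 + |x|^2 + h^2], each pair of neighbours contributes [2 S / (S^2 - 4 h^2 x_i^2)].
    Since [4 h^2 x_i^2 <= S^2 / 16], this is at most [2 / S + (128 / 15) h^2 x_i^2 / S^3]. The sum
    of the errors, at most [(128 / 15) h^2 / S^2], is beaten by the gain
    [2 d h^2 / S^2 >= 10 h^2 / S^2]. *)
Lemma dlap_barrier_le0 (R : realType) (d : nat) (h : R) (x : 'rV[R]_d) :
  (5 <= d)%N -> 0 < h -> h <= 1 -> dlap h (@barrier R d) x <= 0.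
Proof.
move=> d5 h0 h1; set Q := 16 + sqnorm x; set S := Q + h ^+ 2.
have Q16 : 16 <= Q by rewrite lerDl sqnorm_ge0.
have h2 : 0 < h ^+ 2 by rewrite exprn_gt0.
have h21 : h ^+ 2 <= 1 by rewrite expr_le1 // ltW.
have S0 : 0 < S by rewrite /S; lra.
have Q0 : 0 < Q by lra.
have key i : barrier (x + h *: 'e_i) + barrier (x - h *: 'e_i) - 2 * barrier x <=
    2 / S + 128 / 15 * h ^+ 2 / S ^+ 3 * x 0 i ^+ 2 - 2 / Q.
  rewrite -scaleNr /barrier !sqnorm_step -/Q.
  have -> : 16 + (sqnorm x + h ^+ 2 + 2 * h * x 0 i) = S + 2 * h * x 0 i.
    by rewrite /S /Q; ring.
  have -> : 16 + (sqnorm x + (- h) ^+ 2 + 2 * - h * x 0 i) = S - 2 * h * x 0 i.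
    by rewrite /S /Q; ring.
  have xS : x 0 i ^+ 2 + 16 <= S by rewrite /S /Q; have := le_sqnorm x i; lra.
  set y := x 0 i in xS *.
  have x2 : 0 <= y ^+ 2 by exact: sqr_ge0.
  have hx : (h * y) ^+ 2 <= y ^+ 2 by rewrite exprMn ler_piMl.
  have SS : 64 * (h * y) ^+ 2 <= S ^+ 2.
    apply: le_trans (_ : (y ^+ 2 + 16) ^+ 2 <= _); last first.
      by rewrite ler_pXn2r ?nnegrE //; lra.
    have := sqr_ge0 (y ^+ 2 - 16); lra.
  have SS0 : 0 < S ^+ 2 by rewrite exprn_gt0.
  have D0 : 0 < S ^+ 2 - 4 * (h * y) ^+ 2 by have := sqr_ge0 (h * y); lra.
  have Dp : (S + 2 * h * y) * (S - 2 * h * y) = S ^+ 2 - 4 * (h * y) ^+ 2 by ring.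
  have [p0 m0] : S + 2 * h * y != 0 /\ S - 2 * h * y != 0.
    by move: D0; rewrite -Dp => /gt_eqF/negbT; rewrite mulf_eq0 negb_or => /andP.
  rewrite lerD2r.
  have -> : (S + 2 * h * y)^-1 + (S - 2 * h * y)^-1 =
      2 * S / (S ^+ 2 - 4 * (h * y) ^+ 2).
    by rewrite -Dp; field; rewrite p0 m0.
  rewrite ler_pdivrMr //.
  set v := (h * y) ^+ 2 in SS D0 *.
  have -> : (2 / S + 128 / 15 * h ^+ 2 / S ^+ 3 * y ^+ 2) * (S ^+ 2 - 4 * v) =
     2 * S + v * (8 / 15 * (S ^+ 2 - 64 * v)) / S ^+ 3.
    by rewrite /v; field; rewrite gt_eqF.
  rewrite lerDl divr_ge0 ?exprn_ge0 ?(ltW S0) // mulr_ge0 ?sqr_ge0 // mulr_ge0 //.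
  by rewrite subr_ge0.
apply: le_trans (_ : \sum_(i < d) (2 / S + 128 / 15 * h ^+ 2 / S ^+ 3 * x 0 i ^+ 2 - 2 / Q) <= _).
  by apply: ler_sum => i _; exact: key.
rewrite sumrB big_split /= !sumr_const card_ord -mulr_sumr -/(sqnorm x).
rewrite -[_ / S *+ _]mulr_natl -[_ / Q *+ _]mulr_natl.
have D : 5 <= d%:R :> R by rewrite ler_nat.
have S20 : 0 < S ^+ 2 by rewrite exprn_gt0.
have A1 : 128 / 15 * h ^+ 2 / S ^+ 3 * sqnorm x <= 128 / 15 * h ^+ 2 / S ^+ 2.
  have -> : 128 / 15 * h ^+ 2 / S ^+ 3 * sqnorm x =
     128 / 15 * h ^+ 2 / S ^+ 2 * (sqnorm x / S) by field; rewrite gt_eqF.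
  rewrite ler_piMr ?divr_ge0 ?mulr_ge0 ?ltW //.
  by rewrite ltr_pdivrMr // /S /Q; lra.
have A2 : 2 / S - 2 / Q <= - (2 * h ^+ 2 / S ^+ 2).
  have -> : 2 / S - 2 / Q = - (2 * h ^+ 2 / (S * Q)).
    by rewrite /S; field; rewrite !gt_eqF.
  rewrite lerN2 ler_pM2l ?mulr_gt0 // lef_pV2 ?posrE ?mulr_gt0 //.
  by rewrite expr2 ler_pM2l // /S; lra.
have A3 : d%:R * (2 / S - 2 / Q) <= - (10 * h ^+ 2 / S ^+ 2).
  apply: le_trans (_ : d%:R * - (2 * h ^+ 2 / S ^+ 2) <= _); first by rewrite ler_wpM2l //; lra.
  have : 0 < h ^+ 2 / S ^+ 2 by rewrite divr_gt0.
  by move: (h ^+ 2 / S ^+ 2) => q q0 /=; rewrite -!mulrA -/q; nra.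
have : 0 < h ^+ 2 / S ^+ 2 by rewrite divr_gt0.
move: A1 A3; rewrite -!mulrA; lra.
Qed.

Lemma barrier_lipschitz (R : realType) (d : nat) (x y : 'rV[R]_d) :
  `|barrier x - barrier y| <= 2 * d%:R * `|x - y|.
Proof.
have Qg (z : 'rV[R]_d) : 16 <= 16 + sqnorm z by rewrite lerDl sqnorm_ge0.
have Q0 (z : 'rV[R]_d) : 0 < 16 + sqnorm z by have := Qg z; lra.
have b1 (z : 'rV[R]_d) i : `|z 0 i| * barrier z <= 1.
  rewrite /barrier ler_pdivrMr // mul1r.
  have : `|z 0 i| ^+ 2 <= sqnorm z by rewrite real_normK ?num_real // le_sqnorm.
  have := sqnorm_ge0 z; have := sqr_ge0 (`|z 0 i| - 1); lra.
have -> : barrier x - barrier y = barrier x * barrier y * (sqnorm y - sqnorm x).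
  by rewrite /barrier; field; rewrite !gt_eqF.
rewrite /sqnorm -sumrB mulr_sumr; apply: le_trans (ler_norm_sum _ _ _) _.
apply: le_trans (_ : \sum_(i < d) 2 * `|x - y| <= _); last first.
  by rewrite sumr_const card_ord -[_ * _ *+ _]mulr_natl mulrA [_ * 2]mulrC.
apply: ler_sum => i _.
rewrite subr_sqr !normrM (gtr0_norm (barrier_gt0 x)) (gtr0_norm (barrier_gt0 y)).
have xy : `|y 0 i - x 0 i| <= `|x - y|.
  by rewrite distrC; have := rV_coord_le_norm (x - y) i; rewrite !mxE.
have s2 : barrier x * barrier y * `|y 0 i + x 0 i| <= 2.
  apply: le_trans (_ : barrier x * barrier y * (`|y 0 i| + `|x 0 i|) <= _).
    by rewrite ler_wpM2l ?ler_normD // mulr_ge0 // ltW // barrier_gt0.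
  have -> : barrier x * barrier y * (`|y 0 i| + `|x 0 i|) =
     barrier x * (`|y 0 i| * barrier y) + barrier y * (`|x 0 i| * barrier x) by ring.
  have := b1 x i; have := b1 y i.
  have := barrier_gt0 x; have := barrier_gt0 y.
  have := barrier_le1 x; have := barrier_le1 y.
  have := mulr_ge0 (normr_ge0 (y 0 i)) (ltW (barrier_gt0 y)).
  have := mulr_ge0 (normr_ge0 (x 0 i)) (ltW (barrier_gt0 x)).
  move: (`|y 0 i| * barrier y) (`|x 0 i| * barrier x) (barrier x) (barrier y).
  by move=> a b c e *; nra.
rewrite [`|y 0 i - _| * _]mulrC mulrA ler_pM // !mulr_ge0 //;
  by rewrite ltW // barrier_gt0.
Qed.

Lemma superharmonic_limit_barrier (R : realType) (d : nat) (U : set_system R) :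
  UltraFilter U -> 0^'+ `<=` U -> (5 <= d)%N ->
  superharmonic_limit U (@barrier R d).
Proof.
move=> UU hU d5; exists (fun _ => @barrier R d), id, (2 * d%:R); split.
- by rewrite mulr_ge0.
- apply: filterS (near_small _ hU ltr01) => h /andP[h0 h1]; split=> //.
    exact: barrier_lipschitz.
  by move=> x; apply: dlap_barrier_le0 => //; exact: ltW.
- exact: ultra_cvg0.
- by move=> x; exact: cvg_cst.
Qed.

(* A positive maximum of [w1 - w2 - e * barrier] would be a point where
   [w1 - e * barrier], which is strictly subharmonic there, touches [w2] from
   below. *)
Lemma harmonic_comparison (R : realType) (d : nat) (U : set_system R)
    (w1 w2 : 'rV[R]_d -> R) (A : set 'rV[R]_d) :
  UltraFilter U -> (5 <= d)%N ->
  continuous w1 -> open A -> harmonic_on A w1 ->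
  (forall e, 0 < e -> exists2 r, 0 < r & forall x, r <= `|x| -> w1 x <= e) ->
  superharmonic_limit U w2 -> (forall x, 0 <= w2 x) ->
  (forall x, ~ A x -> w1 x <= w2 x) ->
  forall x, w1 x <= w2 x.
Proof.
move=> UU d5 cw1 oA [C1 L1] w1inf sw2 w20 w12 y.
rewrite leNgt; apply/negP => wy.
(* As [barrier <= 1], subtracting [e * barrier] spends at most half of the excess at [y], while [r]
   is chosen so that [F <= e / 2] beyond it. The maximum over the ball is therefore global. *)
pose e := (w1 y - w2 y) / 2.
have e0 : 0 < e by rewrite divr_gt0 // subr_gt0.
have [r r0 rP] := w1inf _ (divr_gt0 e0 (ltr0Sn _ 1)).
pose F x := w1 x - w2 x - e * barrier x.
have Fy : e <= F y.
  have := barrier_le1 y; have : w1 y - w2 y = 2 * e by rewrite /e; field.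
  rewrite /F => ->; nra.
have Fout x : r <= `|x| -> F x <= e / 2.
  move=> /rP; rewrite /F; have := w20 x.
  have := mulr_gt0 e0 (barrier_gt0 x); lra.
have yr : `|y| < r by rewrite ltNge; apply/negP => /Fout; lra.
have [Lw Lw0 w2L] := superharmonic_limit_lipschitz UU sw2.
have ballN : [set x : 'rV[R]_d | `|x - 0| <= r] !=set0.
  by exists y; rewrite /= subr0 ltW.
have [|P] := EVT_max_rV ballN (@compact_ball R d 0 r r0) (f := F).
  apply: continuous_subspaceT => x; suff : {for x, continuous F} by [].
  apply: continuousB.
    by apply: continuousB; [exact: cw1|exact: lipschitz_continuous (w2L x)].
  apply: continuousM; first exact: cst_continuous.
  exact: lipschitz_continuous (barrier_lipschitz x).
rewrite inE /= => Pr Pmax.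
have FP x : F x <= F P.
  have [xr|xr] := ltP `|x| r; first by apply: Pmax; rewrite inE /= subr0 ltW.
  apply: le_trans (Fout x xr) _.
  have : F y <= F P by apply: Pmax; rewrite inE /= subr0 ltW.
  lra.
have AP : A P.
  apply: contrapT => /w12 wP; have := FP y; rewrite {2}/F.
  have := mulr_gt0 e0 (barrier_gt0 P); lra.
pose phi x := w1 x + (- e) * barrier x + (- F P).
have J := jet2D (jet2D (C2_on_jet2 C1) (jet2Z (- e) (@jet2_barrier R d A)))
  (@jet2_cst R d A (- F P)).
have Cphi : C2_on A phi := jet2_C2_on oA J.
have := superharmonic_limit_viscosity UU sw2 oA AP Cphi _ _.
rewrite (jet2_laplacian oA J AP) /phi /F.
move=> H; have : \sum_(i < d) (partial i (partial i w1) P + - e *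
   (2 * barrier P ^+ 3 * (2 * P 0 i) * (2 * P 0 i) - barrier P ^+ 2 * (2 * (i == i)%:R))
   + 0) <= 0.
  apply: H; first by ring.
  by near=> x; have := FP x; rewrite /F; lra.
rewrite big_split /= big_split /= -mulr_sumr big1_eq addr0.
have -> : \sum_(i < d) partial i (partial i w1) P = 0 by exact: L1.
have := laplacian_barrier_lt0 P d5; set s := \sum_(i < d) _ => s0.
have : e * s < 0 by rewrite pmulr_rlt0.
lra.
Unshelve. all: by end_near. Qed.

(** * The quartic obstacle *)

Definition thin_coord {n : nat} (i : 'I_n.+1) : bool := i != ord_max.

Definition thin_sum2 (R : realType) (n : nat) (x : 'rV[R]_n.+1) : R :=
  \sum_(i < n.+1) (thin_coord i)%:R * x 0 i ^+ 2.

Definition thin_sum4 (R : realType) (n : nat) (x : 'rV[R]_n.+1) : R :=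
  \sum_(i < n.+1) (thin_coord i)%:R * x 0 i ^+ 4.

(* Small enough for [flat * 8 ^ 4 + 36 / 80 < 1], the inequality that refutes
   convexity at the point at distance 8 from the origin on an axis. *)
Definition flat (R : realType) : R := 1 / (100 * 100).

(* [2 \sum_(i < j) x_i^2 x_j^2 + flat * \sum_i x_i^4]: its sublevel sets have
   long thin spikes along the axes. *)
Definition spiky (R : realType) (n : nat) (x : 'rV[R]_n.+1) : R :=
  thin_sum2 x ^+ 2 - (1 - flat R) * thin_sum4 x.

(** The even extension [P - 1 - z^2 / 2 * Lap P + z^4 / 24 * Lap^2 P] with [z = x_{n+1}]. In four
    thin variables [Lap P = 12 (1 + flat) |x'|^2] and [Lap^2 P = 96 (1 + flat)]. *)
Definition harmonic_spiky (R : realType) (x : 'rV[R]_5) : R :=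
  spiky x - 1 - 6 * (1 + flat R) * (x 0 ord_max ^+ 2 * thin_sum2 x) +
  4 * (1 + flat R) * x 0 ord_max ^+ 4.

(* The slope 40000 is large enough that the least supersolutions above this
   obstacle touch it only at distance less than the step from the thin space. *)
Definition wedge (R : realType) (n : nat) (x : 'rV[R]_n.+1) : R :=
  1 - spiky x - 400 * 100 * `|x 0 ord_max|.

Lemma flat_gt0 (R : realType) : 0 < flat R.
Proof. by rewrite divr_gt0. Qed.

Lemma flatE (R : realType) : 100 * 100 * flat R = 1.
Proof. by rewrite /flat; field. Qed.

Lemma thin_sum2_ge0 (R : realType) (n : nat) (x : 'rV[R]_n.+1) :
  0 <= thin_sum2 x.
Proof. by apply: sumr_ge0 => i _; rewrite mulr_ge0 ?sqr_ge0. Qed.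

Lemma thin_sum4_ge0 (R : realType) (n : nat) (x : 'rV[R]_n.+1) :
  0 <= thin_sum4 x.
Proof. by apply: sumr_ge0 => i _; rewrite mulr_ge0 // -[4%N]/(2 * 2)%N exprM sqr_ge0. Qed.

Lemma thin_sum2_ge (R : realType) (n : nat) (x : 'rV[R]_n.+1) i :
  thin_coord i -> x 0 i ^+ 2 <= thin_sum2 x.
Proof.
move=> ti; rewrite /thin_sum2 (bigD1 i) //= ti mul1r lerDl.
by apply: sumr_ge0 => j _; rewrite mulr_ge0 ?sqr_ge0.
Qed.

Lemma thin_sum4_ge (R : realType) (n : nat) (x : 'rV[R]_n.+1) i :
  thin_coord i -> x 0 i ^+ 4 <= thin_sum4 x.
Proof.
move=> ti; rewrite /thin_sum4 (bigD1 i) //= ti mul1r lerDl.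
by apply: sumr_ge0 => j _; rewrite mulr_ge0 // -[4%N]/(2 * 2)%N exprM sqr_ge0.
Qed.

Lemma thin_sum2_le (R : realType) (n : nat) (x : 'rV[R]_n.+1) :
  thin_sum2 x <= sqnorm x.
Proof.
by apply: ler_sum => i _; case: thin_coord; rewrite ?mul1r ?mul0r ?sqr_ge0.
Qed.

Lemma thin_sum4_le (R : realType) (n : nat) (x : 'rV[R]_n.+1) :
  thin_sum4 x <= thin_sum2 x ^+ 2.
Proof.
rewrite expr2 {1}/thin_sum2 mulr_suml; apply: ler_sum => i _.
case ti: (thin_coord i); last by rewrite !mul0r.
rewrite !mul1r -[4%N]/(2 + 2)%N exprD ler_wpM2l ?sqr_ge0 //.
exact: thin_sum2_ge.
Qed.

Lemma spiky_ge (R : realType) (n : nat) (x : 'rV[R]_n.+1) :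
  flat R * thin_sum4 x <= spiky x.
Proof. by have := thin_sum4_le x; rewrite /spiky; lra. Qed.

Lemma spiky_ge0 (R : realType) (n : nat) (x : 'rV[R]_n.+1) : 0 <= spiky x.
Proof.
apply: le_trans (spiky_ge x).
by rewrite mulr_ge0 ?thin_sum4_ge0 // ltW // flat_gt0.
Qed.

Lemma wedge_le1 (R : realType) (n : nat) (x : 'rV[R]_n.+1) : wedge x <= 1.
Proof. by have := spiky_ge0 x; have := normr_ge0 (x 0 ord_max); rewrite /wedge; lra. Qed.

Lemma wedge_le (R : realType) (n : nat) (x : 'rV[R]_n.+1) :
  wedge x <= 1 - spiky x.
Proof. by have := normr_ge0 (x 0 ord_max); rewrite /wedge; lra. Qed.

Lemma wedge_thin (R : realType) (n : nat) (x : 'rV[R]_n.+1) :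
  x 0 ord_max = 0 -> wedge x = 1 - spiky x.
Proof. by rewrite /wedge => ->; rewrite normr0 mulr0 subr0. Qed.

(** The length 10 of the spikes is the inverse fourth root of [flat]. *)
Lemma spiky_bounded (R : realType) (n : nat) (x : 'rV[R]_n.+1) i :
  spiky x <= 1 -> thin_coord i -> `|x 0 i| <= 10.
Proof.
move=> x1 ti; have := spiky_ge x.
have := thin_sum4_ge x ti; have := flatE R; have := flat_gt0 R => e0 eE x4 sx.
have {}x4 : x 0 i ^+ 4 <= 100 * 100 by nra.
rewrite leNgt; apply/negP => xi.
have : 100 < `|x 0 i| ^+ 2 by nra.
have -> : `|x 0 i| ^+ 2 = x 0 i ^+ 2 by rewrite real_normK ?num_real.
move=> x2; move: x4; rewrite -[4%N]/(2 * 2)%N exprM; nra.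
Qed.

Lemma wedge_bounded (R : realType) (n : nat) (x : 'rV[R]_n.+1) i :
  0 <= wedge x -> `|x 0 i| <= 10.
Proof.
move=> w0; have [ti|] := boolP (thin_coord i).
  by apply: spiky_bounded ti; have := wedge_le x; lra.
rewrite negbK => /eqP ->; have := spiky_ge0 x; move: w0; rewrite /wedge; lra.
Qed.

Lemma thin_sum2Z (R : realType) (n : nat) (x : 'rV[R]_n.+1) a :
  thin_sum2 (a *: x) = a ^+ 2 * thin_sum2 x.
Proof. by rewrite /thin_sum2 mulr_sumr; apply: eq_bigr => i _; rewrite mxE; ring. Qed.

Lemma thin_sum4Z (R : realType) (n : nat) (x : 'rV[R]_n.+1) a :
  thin_sum4 (a *: x) = a ^+ 4 * thin_sum4 x.
Proof. by rewrite /thin_sum4 mulr_sumr; apply: eq_bigr => i _; rewrite mxE; ring. Qed.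

Lemma spikyZ (R : realType) (n : nat) (x : 'rV[R]_n.+1) a :
  spiky (a *: x) = a ^+ 4 * spiky x.
Proof. by rewrite /spiky thin_sum2Z thin_sum4Z; ring. Qed.

Lemma thin_sum2_0 (R : realType) (n : nat) : thin_sum2 (0 : 'rV[R]_n.+1) = 0.
Proof. by rewrite -[X in thin_sum2 X](scale0r 0) thin_sum2Z expr0n mul0r. Qed.

Lemma thin_sum4_0 (R : realType) (n : nat) : thin_sum4 (0 : 'rV[R]_n.+1) = 0.
Proof. by rewrite -[X in thin_sum4 X](scale0r 0) thin_sum4Z expr0n mul0r. Qed.

Lemma spiky0 (R : realType) (n : nat) : spiky (0 : 'rV[R]_n.+1) = 0.
Proof. by rewrite /spiky thin_sum2_0 thin_sum4_0 expr0n mulr0 subr0. Qed.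

Lemma thin_sum2_step (R : realType) (n : nat) (x : 'rV[R]_n.+1) h i :
  thin_coord i ->
  thin_sum2 (x + h *: 'e_i) = thin_sum2 x + 2 * h * x 0 i + h ^+ 2.
Proof.
move=> ti; rewrite /thin_sum2 (bigD1 i) //= [in RHS](bigD1 i) //= ti.
rewrite (eq_bigr (fun j => (thin_coord j)%:R * x 0 j ^+ 2)) => [|j /negbTE ji].
  by rewrite !mxE !eqxx /=; ring.
by rewrite !mxE ji /= mulr0 addr0.
Qed.

Lemma thin_sum4_step (R : realType) (n : nat) (x : 'rV[R]_n.+1) h i :
  thin_coord i ->
  thin_sum4 (x + h *: 'e_i) = thin_sum4 x + (x 0 i + h) ^+ 4 - x 0 i ^+ 4.
Proof.
move=> ti; rewrite /thin_sum4 (bigD1 i) //= [in RHS](bigD1 i) //= ti.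
rewrite (eq_bigr (fun j => (thin_coord j)%:R * x 0 j ^+ 4)) => [|j /negbTE ji].
  by rewrite !mxE !eqxx /=; ring.
by rewrite !mxE ji /= mulr0 addr0.
Qed.

Lemma thin_sum2_le_bound (R : realType) (x : 'rV[R]_5) (b : R) :
  (forall i, thin_coord i -> `|x 0 i| <= b) -> thin_sum2 x <= 5 * b ^+ 2.
Proof.
move=> xb; apply: le_trans (_ : \sum_(i < 5) b ^+ 2 <= _); last first.
  by rewrite sumr_const card_ord -[_ *+ 5]mulr_natl.
apply: ler_sum => i _; case ti: (thin_coord i); last by rewrite mul0r sqr_ge0.
rewrite mul1r -real_normK ?num_real //; have := xb i ti; have := normr_ge0 (x 0 i).
by move: `|x 0 i| => t *; nra.
Qed.

(** Where the wedge is positive the thin coordinates are at most 10, hence [thin_sum2 x <= 500]; the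
    terms of the second difference of [spiky] then add up to at most [(2000 + 800 + 2) h^2]. *)
Lemma wedge_second_difference (R : realType) (h : R) (i : 'I_5) (x : 'rV[R]_5) :
  0 < h -> h <= 1 -> thin_coord i -> 0 < wedge x ->
  - (3000 * h ^+ 2) <=
    wedge (x + h *: 'e_i) + wedge (x - h *: 'e_i) - 2 * wedge x.
Proof.
move=> h0 h1 ti wx.
have x1 : spiky x <= 1 by have := wedge_le x; lra.
have zE t : (x + t *: 'e_i) 0 ord_max = x 0 ord_max.
  by rewrite !mxE; move: ti; rewrite /thin_coord eq_sym => /negbTE -> /=; ring.
rewrite -[- (h *: _)]scaleNr /wedge !zE /spiky !thin_sum2_step // !thin_sum4_step //.
have s10 := spiky_bounded x1 ti.
have q500 : thin_sum2 x <= 5 * 10 ^+ 2.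
  by apply: thin_sum2_le_bound => j; exact: spiky_bounded x1.
have q0 := thin_sum2_ge0 x; have := flatE R; have := flat_gt0 R.
set s := x 0 i in s10 *; move: (thin_sum2 x) (thin_sum4 x) q500 q0 => q r q500 q0.
move: (flat R) => e e0 eE.
have s2 : s ^+ 2 <= 100.
  by rewrite -real_normK ?num_real //; have := normr_ge0 s; move: `|s| s10 => t *; nra.
have s20 : 0 <= s ^+ 2 by exact: sqr_ge0.
have h20 : 0 < h ^+ 2 by rewrite exprn_gt0.
have h21 : h ^+ 2 <= 1 by rewrite expr_le1 // ltW.
have E : 4 * q * h ^+ 2 + 2 * h ^+ 4 + 8 * (h ^+ 2 * s ^+ 2) -
    (1 - e) * (12 * (s ^+ 2 * h ^+ 2) + 2 * h ^+ 4) <= 3000 * h ^+ 2.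
  have a1 : q * h ^+ 2 <= 500 * h ^+ 2 by rewrite ler_wpM2r //; lra.
  have a2 : s ^+ 2 * h ^+ 2 <= 100 * h ^+ 2 by rewrite ler_wpM2r //; lra.
  have a3 : h ^+ 4 <= h ^+ 2.
    by rewrite -[4%N]/(2 + 2)%N exprD ler_piMr // ltW.
  have a4 : 0 <= (1 - e) * (12 * (s ^+ 2 * h ^+ 2) + 2 * h ^+ 4).
    have : 0 <= s ^+ 2 * h ^+ 2 by rewrite mulr_ge0 // ltW.
    have : 0 <= h ^+ 4 by rewrite exprn_ge0 // ltW.
    by move=> *; rewrite mulr_ge0 //; lra.
  lra.
lra.
Qed.

(** A quartic is not globally Lipschitz, but only points with [wedge x >= 0] matter, and these lie
    in a box. For [|x - y| >= 1] the bound [wedge <= 1] suffices; otherwise both points have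
    coordinates at most 11. *)
Lemma wedge_lipschitz (R : realType) (x y : 'rV[R]_5) :
  wedge x <= Num.max 0 (wedge y) + 2000 * 100 * `|x - y|.
Proof.
have n0 := normr_ge0 (x - y).
have m0 : 0 <= Num.max 0 (wedge y) by rewrite le_max lexx.
have [wx|wx] := ltP (wedge x) 0; first lra.
have [n1|n1] := leP 1 `|x - y|; first by have := wedge_le1 x; lra.
suff : wedge x <= wedge y + 2000 * 100 * `|x - y|.
  have : wedge y <= Num.max 0 (wedge y) by rewrite le_max lexx orbT.
  lra.
set t := `|x - y| in n0 n1 *.
have xi i := wedge_bounded i wx.
have xyi i : `|x 0 i - y 0 i| <= t.
  by have := rV_coord_le_norm (x - y) i; rewrite !mxE.
have yi i : `|y 0 i| <= 11.
  have := ler_normB (x 0 i) (x 0 i - y 0 i); rewrite subKr.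
  by have := xi i; have := xyi i; lra.
have d2 i : `|y 0 i ^+ 2 - x 0 i ^+ 2| <= 21 * t.
  rewrite subr_sqr normrM mulrC ler_pM // 1?distrC //.
  by apply: le_trans (ler_normD _ _) _; have := xi i; have := yi i; lra.
have sq (a b : R) : `|a| <= b -> 0 <= b -> a ^+ 2 <= b ^+ 2.
  move=> ab b0; rewrite -[leLHS]real_normK ?num_real //.
  by rewrite ler_pXn2r // nnegrE.
have d4 i : `|y 0 i ^+ 4 - x 0 i ^+ 4| <= 221 * (21 * t).
  rewrite -[4%N]/(2 * 2)%N !exprM subr_sqr normrM mulrC.
  rewrite ler_pM // ger0_norm ?addr_ge0 ?sqr_ge0 //.
  by have := sq _ _ (xi i) ltac:(lra); have := sq _ _ (yi i) ltac:(lra); lra.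
have s2 : `|thin_sum2 y - thin_sum2 x| <= 105 * t.
  rewrite /thin_sum2 -sumrB; apply: le_trans (ler_norm_sum _ _ _) _.
  apply: le_trans (_ : \sum_(i < 5) 21 * t <= _); last first.
    by rewrite sumr_const card_ord -[_ * _ *+ 5]mulr_natl; lra.
  apply: ler_sum => i _; rewrite -mulrBr normrM.
  case: thin_coord; rewrite ?normr1 ?normr0 ?mul1r ?mul0r //; lra.
have s4 : `|thin_sum4 y - thin_sum4 x| <= 1105 * (21 * t).
  rewrite /thin_sum4 -sumrB; apply: le_trans (ler_norm_sum _ _ _) _.
  apply: le_trans (_ : \sum_(i < 5) 221 * (21 * t) <= _); last first.
    by rewrite sumr_const card_ord -[_ * _ *+ 5]mulr_natl; lra.
  apply: ler_sum => i _; rewrite -mulrBr normrM.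
  case: thin_coord; rewrite ?normr1 ?normr0 ?mul1r ?mul0r //; lra.
have qx : thin_sum2 x <= 5 * 11 ^+ 2.
  by apply: thin_sum2_le_bound => i _; have := xi i; lra.
have qy : thin_sum2 y <= 5 * 11 ^+ 2 by apply: thin_sum2_le_bound => i _.
have q2 : thin_sum2 y ^+ 2 - thin_sum2 x ^+ 2 <= 1210 * (105 * t).
  rewrite subr_sqr; have := thin_sum2_ge0 x; have := thin_sum2_ge0 y.
  move: s2; rewrite ler_norml => /andP[_].
  move: (thin_sum2 x) (thin_sum2 y) qx qy => a b *; nra.
have zz : `|y 0 ord_max| - `|x 0 ord_max| <= t.
  have := xyi ord_max; have := ler_normB (x 0 ord_max) (x 0 ord_max - y 0 ord_max).
  by rewrite subKr; lra.
have e4 : - ((1 - flat R) * (thin_sum4 y - thin_sum4 x)) <= 1105 * (21 * t).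
  move: s4; rewrite ler_norml => /andP[s4 _].
  have := flatE R; have := flat_gt0 R; move: (flat R) (thin_sum4 y - _) s4 => e b *.
  nra.
rewrite /wedge /spiky; lra.
Qed.

Lemma thin_sum2_signed_perm (R : realType) (n : nat) (s : 'I_n.+1 -> R) p
    (x : 'rV[R]_n.+1) :
  involutive p -> (forall i, s i = 1 \/ s i = -1) -> p ord_max = ord_max ->
  thin_sum2 (signed_perm s p x) = thin_sum2 x /\
  thin_sum4 (signed_perm s p x) = thin_sum4 x.
Proof.
move=> pK s1 pm.
have tp i : thin_coord (p i) = thin_coord i.
  by rewrite /thin_coord -{1}pm (inj_eq (inv_inj pK)).
split; rewrite /thin_sum2 /thin_sum4 [RHS](reindex_inj (inv_inj pK));
  apply: eq_bigr => i _; rewrite /= tp mxE exprMn;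
  by case: (s1 i) => ->; rewrite ?expr1n ?sqrrN ?expr1n ?mul1r // -[4%N]/(2 * 2)%N [in (-1) ^+ _]exprM sqrrN !expr1n mul1r.
Qed.

Lemma wedge_signed_perm (R : realType) (n : nat) (s : 'I_n.+1 -> R) p
    (x : 'rV[R]_n.+1) :
  involutive p -> (forall i, s i = 1 \/ s i = -1) -> p ord_max = ord_max ->
  wedge (signed_perm s p x) = wedge x.
Proof.
move=> pK s1 pm; have [E2 E4] := thin_sum2_signed_perm x pK s1 pm.
rewrite /wedge /spiky E2 E4 mxE pm normrM.
by case: (s1 ord_max) => ->; rewrite ?normrN normr1 mul1r.
Qed.

Lemma harmonic_spiky_signed_perm (R : realType) (s : 'I_5 -> R) p
    (x : 'rV[R]_5) :
  involutive p -> (forall i, s i = 1 \/ s i = -1) -> p ord_max = ord_max ->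
  harmonic_spiky (signed_perm s p x) = harmonic_spiky x.
Proof.
move=> pK s1 pm; have [E2 E4] := thin_sum2_signed_perm x pK s1 pm.
rewrite /harmonic_spiky /spiky E2 E4 mxE pm.
by case: (s1 ord_max) => ->; ring.
Qed.

Lemma harmonic_spiky_thin (R : realType) (x : 'rV[R]_5) :
  x 0 ord_max = 0 -> harmonic_spiky x = spiky x - 1.
Proof. by rewrite /harmonic_spiky => ->; ring. Qed.

Lemma jet2_thin_sum2 (R : realType) (n : nat) (A : set 'rV[R]_n.+1) :
  jet2_on A (@thin_sum2 R n) (fun i x => (thin_coord i)%:R * (2 * x 0 i))
    (fun i j _ => (thin_coord i)%:R * (2 * (j == i)%:R)).
Proof.
have J := jet2_sum (fun k : 'I_n.+1 => jet2Z (thin_coord k)%:R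
  (jet2M (@jet2_coord R _ A k) (@jet2_coord R _ A k))).
apply: jet2_eq J => [x|i x|i j x].
- by apply: eq_bigr => k _; rewrite expr2.
- rewrite (bigD1 i) //= big1 ?addr0 => [|k /negbTE ki]; last by rewrite ki /=; ring.
  by rewrite eqxx /=; ring.
- rewrite (bigD1 i) //= big1 ?addr0 => [|k /negbTE ki]; last by rewrite ki /=; ring.
  by rewrite eqxx [i == j]eq_sym /=; ring.
Qed.

Lemma jet2_thin_sum4 (R : realType) (n : nat) (A : set 'rV[R]_n.+1) :
  jet2_on A (@thin_sum4 R n) (fun i x => (thin_coord i)%:R * (4 * x 0 i ^+ 3))
    (fun i j x => (thin_coord i)%:R * (12 * x 0 i ^+ 2 * (j == i)%:R)).
Proof.
have J := jet2_sum (fun k : 'I_n.+1 => jet2Z (thin_coord k)%:R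
  (jet2M (jet2M (@jet2_coord R _ A k) (@jet2_coord R _ A k))
     (jet2M (@jet2_coord R _ A k) (@jet2_coord R _ A k)))).
apply: jet2_eq J => [x|i x|i j x].
- by apply: eq_bigr => k _; ring.
- rewrite (bigD1 i) //= big1 ?addr0 => [|k /negbTE ki]; last by rewrite ki /=; ring.
  by rewrite eqxx /=; ring.
- rewrite (bigD1 i) //= big1 ?addr0 => [|k /negbTE ki]; last by rewrite ki /=; ring.
  by rewrite eqxx [i == j]eq_sym /=; ring.
Qed.

Lemma jet2_harmonic_spiky (R : realType) (A : set 'rV[R]_5) :
  exists g H, jet2_on A (@harmonic_spiky R) g H /\
    forall x, \sum_(i < 5) H i i x = 0.
Proof.
have J2 := @jet2_thin_sum2 R 4 A; have J4 := @jet2_thin_sum4 R 4 A.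
have Jz := @jet2_coord R 5 A ord_max; have Jzz := jet2M Jz Jz.
have J := jet2D (jet2D (jet2D (jet2D (jet2M J2 J2) (jet2Z (- (1 - flat R)) J4))
   (@jet2_cst R 5 A (-1))) (jet2Z (- (6 * (1 + flat R))) (jet2M Jzz J2)))
   (jet2Z (4 * (1 + flat R)) (jet2M Jzz Jzz)).
eexists; eexists; split.
  apply: jet2_eq J => [x|i x|i j x]; [|reflexivity|reflexivity].
  by rewrite /harmonic_spiky /spiky; ring.
move=> x; rewrite (bigD1 ord_max) //=.
rewrite (eq_bigr (fun i : 'I_5 => (4 * thin_sum2 x - 12 * (1 + flat R) * x 0 ord_max ^+ 2) +
  (12 * flat R - 4) * x 0 i ^+ 2)); last first.
  move=> i im; have -> : thin_coord i by [].
  by rewrite eq_sym (negbTE im) !eqxx /=; ring.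
rewrite big_split /= sumr_const -mulr_sumr.
have -> : \sum_(i < 5 | i != ord_max) x 0 i ^+ 2 = thin_sum2 x.
  rewrite /thin_sum2 [RHS](bigD1 ord_max) //= mul0r add0r.
  by apply: eq_bigr => i im; rewrite /thin_coord im mul1r.
(* The cancellation depends on there being exactly four thin directions. *)
have -> : #|[pred i : 'I_5 | i != ord_max]| = 4%N by rewrite cardC1 card_ord.
by rewrite -[_ *+ 4]mulr_natl; ring.
Qed.

(** * The limiting supersolution *)

Definition discrete_sol (R : realType) (h : R) : 'rV[R]_5 -> R :=
  least_supersol h (@wedge R 4).

Definition limit_sol (R : realType) (U : set_system R) (x : 'rV[R]_5) : R :=
  lim ((fun h => discrete_sol h x) @ U).

Lemma discrete_solP (R : realType) (h : R) :
  supersol h (@wedge R 4) (discrete_sol h).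
Proof. exact/least_supersolP/wedge_le1. Qed.

Lemma discrete_sol_le1 (R : realType) (h : R) x : discrete_sol h x <= 1.
Proof. exact: (least_supersol_le x (supersol1 h (@wedge_le1 R 4))). Qed.

Lemma discrete_sol_norm_le (R : realType) (h : R) x : `|discrete_sol h x| <= 1.
Proof. by have [w0 _ _] := discrete_solP h; rewrite ger0_norm // discrete_sol_le1. Qed.

Lemma discrete_sol_lipschitz (R : realType) (h : R) x y :
  `|discrete_sol h x - discrete_sol h y| <= 2000 * 100 * `|x - y|.
Proof.
have L0 : 0 <= 2000 * 100 :> R by lra.
exact: (least_supersol_lip h (@wedge_le1 R 4) L0 (@wedge_lipschitz R)).
Qed.

Lemma sqnorm_le_norm (R : realType) (d : nat) (x : 'rV[R]_d) (b : R) :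
  (forall i, `|x 0 i| <= b) -> sqnorm x <= d%:R * b ^+ 2.
Proof.
move=> xb; apply: le_trans (_ : \sum_(i < d) b ^+ 2 <= _); last first.
  by rewrite sumr_const card_ord -[_ ^+ _ *+ _]mulr_natl.
apply: ler_sum => i _; rewrite -real_normK ?num_real //.
by have := xb i; have := normr_ge0 (x 0 i); move: `|x 0 i| => t *; nra.
Qed.

(** [516 = 16 + 5 * 10^2]: the multiple of the barrier is at least 1 on the box outside which the
    wedge is negative. *)
Lemma discrete_sol_le_barrier (R : realType) (h : R) x :
  0 < h -> h <= 1 -> discrete_sol h x <= 516 * barrier x.
Proof.
move=> h0 h1; apply: (@least_supersol_le _ _ _ _ (fun x => 516 * barrier x)).
split=> y.
- by have := barrier_gt0 y; lra.
- have [wy|wy] := ltP (wedge y) 0.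
    by have := barrier_gt0 y; lra.
  apply: le_trans (wedge_le1 y) _.
  have := @sqnorm_le_norm R 5 y 10 (fun i => wedge_bounded i wy).
  by have q0 := sqnorm_ge0 y; rewrite /barrier ler_pdivlMr; lra.
- by have := dlap_barrier_le0 y (leqnn 5) h0 h1; have := dlapZ h 516 (@barrier R 5) y; lra.
Qed.

Lemma discrete_sol_signed_perm (R : realType) (h : R) (s : 'I_5 -> R) p x :
  involutive p -> (forall i, s i = 1 \/ s i = -1) -> p ord_max = ord_max ->
  (forall i, s (p i) = s i) ->
  discrete_sol h (signed_perm s p x) = discrete_sol h x.
Proof.
move=> pK s1 pm sp; apply: least_supersol_signed_perm => //.
  exact: wedge_le1.
by move=> y; exact: wedge_signed_perm.
Qed.

(* Tangential semiconvexity makes [z |-> discrete_sol h (x', z)] semiconcave.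
   At a contact point with [z >= h] the backward slope is at most the slope of
   the wedge, so the solution would become negative within distance 2. *)
Lemma discrete_sol_gt_wedge_pos (R : realType) (h : R) (x : 'rV[R]_5) :
  0 < h -> h <= 1 / 2 -> h <= x 0 ord_max ->
  wedge x < discrete_sol h x.
Proof.
move=> h0 h12 xh; have [w0 wP wS] := discrete_solP h.
set w := discrete_sol h in w0 wP wS *.
rewrite ltNge; apply/negP => wx.
have h20 : 0 <= h ^+ 2 by exact: sqr_ge0.
have h1 : h <= 1 by lra.
have C0 : 0 <= 3000 :> R by lra.
have sconv (i : 'I_5) (ti : thin_coord i) := least_supersol_semiconvex
  (@wedge_le1 R 4) C0 (fun z => @wedge_second_difference R h i z h0 h1 ti).
(* Superharmonicity with four tangential second differences of at least [- 3000 h^2] leaves at most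
   [12000 h^2] in the direction [z]. *)
have zconc y : w (y + h *: 'e_ord_max) + w (y - h *: 'e_ord_max) - 2 * w y <=
    150 * 100 * h ^+ 2.
  have := wS y; rewrite /dlap (bigD1 ord_max) //= => D.
  have : \sum_(i < 5 | i != ord_max) (- (3000 * h ^+ 2)) <=
     \sum_(i < 5 | i != ord_max) (w (y + h *: 'e_i) + w (y - h *: 'e_i) - 2 * w y).
    by apply: ler_sum => i im; exact: sconv.
  rewrite sumr_const.
  have -> : #|[pred i : 'I_5 | i != ord_max]| = 4%N by rewrite cardC1 card_ord.
  rewrite -[_ *+ 4]mulr_natl; lra.
pose e : 'rV[R]_5 := 'e_ord_max.
pose a (m : nat) := w (x + (m%:R * h) *: e) - w (x + ((m%:R - 1) * h) *: e).
(* [h <= x_{n+1}] keeps [x - h e] on the same side of the thin space, where the wedge is exactly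
   affine in [z]. *)
have a0 : a 0%N <= - (400 * 100 * h).
  have := wP (x - h *: e); rewrite /a mul0r scale0r addr0 sub0r mulN1r scaleNr.
  have : wedge (x - h *: e) = wedge x + 400 * 100 * h.
    rewrite /wedge /spiky.
    have E j : thin_coord j -> (x - h *: e) 0 j = x 0 j.
      by rewrite /thin_coord => /negbTE jm; rewrite !mxE jm /=; ring.
    have -> : thin_sum2 (x - h *: e) = thin_sum2 x.
      by apply: eq_bigr => j _; case tj: (thin_coord j); [rewrite E|rewrite !mul0r].
    have -> : thin_sum4 (x - h *: e) = thin_sum4 x.
      by apply: eq_bigr => j _; case tj: (thin_coord j); [rewrite E|rewrite !mul0r].
    rewrite !mxE /= !mulr1 !ger0_norm; [lra|lra|lra].
  lra.
have aS m : a m.+1 <= a m + 150 * 100 * h ^+ 2.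
  have := zconc (x + (m%:R * h) *: e); rewrite -/e /a -[m.+1%:R]natr1 addrK.
  rewrite -!addrA -scalerDl -scalerBl.
  have -> : m%:R * h + h = (m%:R + 1) * h by ring.
  have -> : m%:R * h - h = (m%:R - 1) * h by ring.
  lra.
have am m : a m <= - (400 * 100 * h) + m%:R * (150 * 100 * h ^+ 2).
  elim: m => [|m IH]; first by rewrite mul0r addr0.
  by have := aS m; rewrite -[m.+1%:R]natr1; lra.
(* Over a height of at most 2 the backward differences grow by at most [30000 h], so they stay below
   [- 10000 h]. *)
have wm m : m%:R * h <= 2 -> w (x + (m%:R * h) *: e) <= 1 - 100 * 100 * (m%:R * h).
  elim: m => [|m IH] mh.
    by rewrite mul0r scale0r addr0 mulr0 subr0 discrete_sol_le1.
  move: mh; rewrite -[m.+1%:R]natr1 => mh.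
  have /IH {}IH : m%:R * h <= 2 by lra.
  have := am m.+1; rewrite /a -[m.+1%:R]natr1 addrK.
  have : (m%:R + 1) * (150 * 100 * h ^+ 2) <= 300 * 100 * h.
    have : h * ((m%:R + 1) * h) <= h * 2 by rewrite ler_wpM2l // ltW.
    lra.
  lra.
(* Rounding in dimension 1 provides [m] with [1 <= m h <= 2], since [h <= 1 / 2]; there the upper
   bound is negative. *)
have [||m mh _] := @grid_floor_step R 1 h (3 / 2) ord0 0 => //.
move: mh; rewrite ler_norml => /andP[m1 m2].
have := wm m; have := w0 (x + (m%:R * h) *: e).
move=> A /(_ _) B; have : m%:R * h <= 2 by lra.
by move=> /B; lra.
Qed.

Lemma discrete_sol_gt_wedge (R : realType) (h : R) (x : 'rV[R]_5) :
  0 < h -> h <= 1 / 2 -> h <= `|x 0 ord_max| ->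
  wedge x < discrete_sol h x.
Proof.
move=> h0 h12; have [x0|x0] := leP 0 (x 0 ord_max).
  by rewrite ger0_norm //; exact: discrete_sol_gt_wedge_pos.
rewrite ltr0_norm //.
pose s (i : 'I_5) : R := if i == ord_max then -1 else 1.
have s1 i : s i = 1 \/ s i = -1 by rewrite /s; case: eqP; [right|left].
rewrite -(@wedge_signed_perm _ _ s id) // -(@discrete_sol_signed_perm _ h s id) //.
move=> xh; apply: discrete_sol_gt_wedge_pos => //.
by rewrite mxE /s eqxx mulN1r.
Qed.

Lemma limit_sol_cvg (R : realType) (U : set_system R) (x : 'rV[R]_5) :
  UltraFilter U -> (fun h => discrete_sol h x) @ U --> limit_sol U x.
Proof.
move=> UU; apply: (@ultra_bounded_cvg _ _ _ _ 1).
by apply: nearW => h; exact: discrete_sol_norm_le.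
Qed.

Lemma limit_sol_ge (R : realType) (U : set_system R) (x : 'rV[R]_5) a :
  UltraFilter U -> (\forall h \near U, a <= discrete_sol h x) ->
  a <= limit_sol U x.
Proof.
move=> UU H; apply: limr_ge H; apply/cvg_ex; exists (limit_sol U x).
exact: limit_sol_cvg.
Qed.

Lemma limit_sol_le (R : realType) (U : set_system R) (x : 'rV[R]_5) a :
  UltraFilter U -> (\forall h \near U, discrete_sol h x <= a) ->
  limit_sol U x <= a.
Proof.
move=> UU H; apply: limr_le H; apply/cvg_ex; exists (limit_sol U x).
exact: limit_sol_cvg.
Qed.

Lemma limit_sol_ge0 (R : realType) (U : set_system R) (x : 'rV[R]_5) :
  UltraFilter U -> 0 <= limit_sol U x.
Proof.
move=> UU; apply: limit_sol_ge; apply: nearW => h.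
by have [] := discrete_solP h.
Qed.

Lemma limit_sol_le1 (R : realType) (U : set_system R) (x : 'rV[R]_5) :
  UltraFilter U -> limit_sol U x <= 1.
Proof.
by move=> UU; apply: limit_sol_le; apply: nearW => h; exact: discrete_sol_le1.
Qed.

Lemma limit_sol_ge_wedge (R : realType) (U : set_system R) (x : 'rV[R]_5) :
  UltraFilter U -> wedge x <= limit_sol U x.
Proof.
move=> UU; apply: limit_sol_ge; apply: nearW => h.
by have [] := discrete_solP h.
Qed.

Lemma limit_sol_le_barrier (R : realType) (U : set_system R) (x : 'rV[R]_5) :
  UltraFilter U -> 0^'+ `<=` U -> limit_sol U x <= 516 * barrier x.
Proof.
move=> UU hU; apply: limit_sol_le.
apply: filterS (near_small _ hU ltr01) => h /andP[h0 h1].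
by apply: discrete_sol_le_barrier => //; exact: ltW.
Qed.

Lemma limit_sol_signed_perm (R : realType) (U : set_system R) (s : 'I_5 -> R) p
    x :
  involutive p -> (forall i, s i = 1 \/ s i = -1) -> p ord_max = ord_max ->
  (forall i, s (p i) = s i) ->
  limit_sol U (signed_perm s p x) = limit_sol U x.
Proof.
move=> pK s1 pm sp; rewrite /limit_sol.
by under eq_fun do rewrite discrete_sol_signed_perm //.
Qed.

Lemma superharmonic_limit_sol (R : realType) (U : set_system R) :
  UltraFilter U -> 0^'+ `<=` U -> superharmonic_limit U (limit_sol U).
Proof.
move=> UU hU; exists (fun h => @discrete_sol R h), id, (2000 * 100); split.
- lra.
- apply: filterS (near_small _ hU ltr01) => h /andP[h0 _]; split=> //.
    exact: discrete_sol_lipschitz.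
  by have [] := discrete_solP h.
- exact: ultra_cvg0.
- by move=> x; exact: limit_sol_cvg.
Qed.

Lemma limit_sol_continuous (R : realType) (U : set_system R) x :
  UltraFilter U -> 0^'+ `<=` U -> {for x, continuous (limit_sol U)}.
Proof.
move=> UU hU.
have [L _ wL] := superharmonic_limit_lipschitz UU (superharmonic_limit_sol UU hU).
exact: lipschitz_continuous (wL x).
Qed.

(** The Lipschitz constant does not depend on [h], so rounding the point to the grid does not change
    the limit. This makes the regularity results for [grid_lim] available. *)
Lemma limit_sol_grid_lim (R : realType) (U : set_system R) :
  UltraFilter U -> 0^'+ `<=` U ->
  grid_lim U (fun h => @discrete_sol R h) = limit_sol U.
Proof.
move=> UU hU; apply/funext => x; apply: cvg_lim => //.
have cv : (fun h => (discrete_sol h (grid_floor h x) - discrete_sol h x) +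
    discrete_sol h x) @ U --> 0 + limit_sol U x.
  apply: cvgD; last exact: limit_sol_cvg.
  apply/cvgr0Pnorm_le => e e0.
  have L0 : 0 < 2000 * 100 :> R by lra.
  have e1 : 0 < e / (2000 * 100) by rewrite divr_gt0.
  apply: filterS (near_small _ hU e1) => h /andP[h0].
  rewrite ltr_pdivlMr // => he.
  apply: le_trans (discrete_sol_lipschitz _ _ _) _.
  have := grid_floor_le x h0; lra.
rewrite add0r in cv; apply: cvg_trans cv; apply: near_eq_cvg.
by near=> h; rewrite subrK.
Unshelve. all: by end_near. Qed.

(** * The contact set *)

Definition thin_solution (R : realType) (U : set_system R) (x : 'rV[R]_5) : R :=
  harmonic_spiky x + limit_sol U x.

Lemma thin_solution_contact (R : realType) (U : set_system R) (x : 'rV[R]_5) :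
  contact_set (thin_solution U) x <->
  x 0 ord_max = 0 /\ limit_sol U x = 1 - spiky x.
Proof.
rewrite /contact_set /thin_solution /=; split=> -[z0];
  rewrite harmonic_spiky_thin // => E; split=> //; lra.
Qed.

Lemma thin_solution_ge0 (R : realType) (U : set_system R) (x : 'rV[R]_5) :
  UltraFilter U -> x 0 ord_max = 0 -> 0 <= thin_solution U x.
Proof.
move=> UU z0; rewrite /thin_solution harmonic_spiky_thin //.
by have := limit_sol_ge_wedge x UU; rewrite wedge_thin //; lra.
Qed.

Lemma thin_solution_continuous (R : realType) (U : set_system R) x :
  UltraFilter U -> 0^'+ `<=` U -> {for x, continuous (thin_solution U)}.
Proof.
move=> UU hU; apply: continuousD; last exact: limit_sol_continuous.
by have [g [H [J _]]] := @jet2_harmonic_spiky R setT; have [] := J x I.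
Qed.

Lemma contact_set_closed (R : realType) (n : nat) (u : 'rV[R]_n.+1 -> R) :
  continuous u -> closed (contact_set u).
Proof.
move=> cu; have -> : contact_set u =
    (fun x : 'rV[R]_n.+1 => x 0 ord_max) @^-1` [set x | x = 0] `&`
    u @^-1` [set x | x = 0] by [].
apply: closedI; apply: preimage_closed => [x _|]; try exact: closed_eq.
  exact: coord_continuous.
exact: cu.
Qed.

Lemma noncontact_open (R : realType) (U : set_system R) :
  UltraFilter U -> 0^'+ `<=` U -> open (~` contact_set (thin_solution U)).
Proof.
move=> UU hU; apply: closed_openC; apply: contact_set_closed => x.
exact: thin_solution_continuous.
Qed.

(** Off the thin space, the absence of contact at height at least [h] is used. On it, [c] has a
    positive gap between [limit_sol] and the obstacle, which persists on a ball independent of [h]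
    by the uniform Lipschitz bound. *)
Lemma discrete_sol_near_harmonic (R : realType) (U : set_system R)
    (c : 'rV[R]_5) :
  UltraFilter U -> 0^'+ `<=` U -> ~ contact_set (thin_solution U) c ->
  exists2 r : R, 0 < r & \forall h \near U, forall x, `|x - c| <= r ->
    `|discrete_sol h x| <= 1 /\ dlap h (discrete_sol h) x = 0.
Proof.
move=> UU hU nc.
have harm h x : 0 < h -> wedge x < discrete_sol h x ->
    `|discrete_sol h x| <= 1 /\ dlap h (discrete_sol h) x = 0.
  move=> h0 wx; split; first exact: discrete_sol_norm_le.
  apply: least_supersol_harmonic => //; first by rewrite gt_eqF.
  exact: wedge_le1.
have [c0|c0] := eqVneq (c 0 ord_max) 0; last first.
  have a0 : 0 < `|c 0 ord_max| / 2 by rewrite divr_gt0 // normr_gt0.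
  exists (`|c 0 ord_max| / 2) => //.
  have m0 : 0 < Num.min (1 / 2) (`|c 0 ord_max| / 2) by rewrite lt_min a0 andbT.
  apply: filterS (near_small _ hU m0) => h /andP[h0].
  rewrite lt_min => /andP[h1 hc] x xc; apply: harm => //.
  apply: discrete_sol_gt_wedge => //; first exact: ltW.
  have := rV_coord_le_norm (x - c) ord_max; rewrite !mxE => xc'.
  have := ler_normB (x 0 ord_max) (x 0 ord_max - c 0 ord_max).
  rewrite subKr; lra.
pose gap := limit_sol U c - (1 - spiky c).
have gap0 : 0 < gap.
  have := limit_sol_ge_wedge c UU; rewrite wedge_thin // => le.
  rewrite /gap lt_neqAle subr_ge0 le andbT eq_sym subr_eq0; apply/eqP => E.
  by apply: nc; apply/thin_solution_contact.
have gapE : limit_sol U c = 1 - spiky c + gap by rewrite /gap; ring.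
clearbody gap.
have cs : {for c, continuous (@spiky R 4)}.
  have J := jet2D (jet2M (@jet2_thin_sum2 R 4 setT) (@jet2_thin_sum2 R 4 setT))
    (jet2Z (- (1 - flat R)) (@jet2_thin_sum4 R 4 setT)).
  have -> : @spiky R 4 = (fun x => thin_sum2 x * thin_sum2 x +
      - (1 - flat R) * thin_sum4 x).
    by apply/funext => x; rewrite /spiky; ring.
  by have [] := J c I.
have N1 : \forall x \near c, spiky c - gap / 4 <= spiky x.
  have lt1 : spiky c - gap / 4 < spiky c by lra.
  exact: (@cvgr_ge _ _ _ (nbhs_filter c) _ _ cs _ lt1).
have [r r0 rP] := near_cball N1.
have L0 : 0 < 2000 * 100 :> R by lra.
(* Variation of [spiky], variation of the discrete solution, and its distance to the limit at [c]
   each consume a quarter of the gap. *)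
pose r' := Num.min r (gap / 4 / (2000 * 100)).
have r'0 : 0 < r' by rewrite lt_min r0 !divr_gt0.
exists r' => //.
have N2 : \forall h \near U, limit_sol U c - gap / 4 < discrete_sol h c.
  have lt1 : limit_sol U c - gap / 4 < limit_sol U c by lra.
  have cv : (fun h => discrete_sol h c) @ U --> limit_sol U c by exact: limit_sol_cvg.
  exact: (cvgr_gt _ cv).
apply: filterS2 N2 (near_small _ hU ltr01) => h hc /andP[h0 _] x.
rewrite le_min ler_pdivlMr // => /andP[xr xg]; apply: harm => //.
have := rP x xr; have := wedge_le x.
have := discrete_sol_lipschitz h x c; rewrite ler_norml => /andP[D _].
lra.
Qed.

Lemma limit_sol_jet2 (R : realType) (U : set_system R) :
  UltraFilter U -> 0^'+ `<=` U ->
  exists g H, jet2_on (~` contact_set (thin_solution U)) (limit_sol U) g H /\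
    forall x, ~ contact_set (thin_solution U) x -> \sum_(i < 5) H i i x = 0.
Proof.
move=> UU hU.
exists (fun i => grid_lim U (fun h => fdiff h i (discrete_sol h))),
  (fun i j => grid_lim U (fun h => fdiff h j (fdiff h i (discrete_sol h)))).
have main x : ~ contact_set (thin_solution U) x -> _ :=
  fun nx => let: ex_intro2 r r0 rP := discrete_sol_near_harmonic UU hU nx in
  grid_lim_harmonic UU hU r0 ltr01 rP.
by split=> x /main; rewrite limit_sol_grid_lim // => -[].
Qed.

Lemma limit_sol_harmonic (R : realType) (U : set_system R) :
  UltraFilter U -> 0^'+ `<=` U ->
  harmonic_on (~` contact_set (thin_solution U)) (limit_sol U).
Proof.
move=> UU hU; have [g [H [J L]]] := limit_sol_jet2 UU hU.
have oA := noncontact_open UU hU.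
split; first exact: jet2_C2_on oA J.
by move=> x Ax; rewrite (jet2_laplacian oA J Ax) L.
Qed.

Lemma thin_solution_harmonic (R : realType) (U : set_system R) :
  UltraFilter U -> 0^'+ `<=` U ->
  harmonic_on (~` contact_set (thin_solution U)) (thin_solution U).
Proof.
move=> UU hU; have [g [H [J L]]] := limit_sol_jet2 UU hU.
have [g' [H' [J' L']]] :=
  @jet2_harmonic_spiky R (~` contact_set (thin_solution U)).
have oA := noncontact_open UU hU.
have JJ := jet2D J' J.
split; first exact: jet2_C2_on oA JJ.
move=> x Ax; rewrite (jet2_laplacian oA JJ Ax) big_split /= L' L //; exact: addr0.
Qed.

(** If [phi] touches [p + w] from below, then [phi - p] touches [w] from below and has the same
    Laplacian, [p] being harmonic everywhere. *)
Lemma thin_solution_superharmonic (R : realType) (U : set_system R) :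
  UltraFilter U -> 0^'+ `<=` U -> viscosity_superharmonic (thin_solution U).
Proof.
move=> UU hU phi x0 Cphi phix philt.
have [g [H [J L]]] := @jet2_harmonic_spiky R setT.
have JJ := jet2D (C2_on_jet2 Cphi) (jet2Z (-1) J).
have C := jet2_C2_on openT JJ.
have := superharmonic_limit_viscosity UU (superharmonic_limit_sol UU hU)
  openT (x0 := x0) I C.
rewrite (jet2_laplacian openT JJ I) big_split /= -mulr_sumr L mulr0 addr0; apply.
  by rewrite phix /thin_solution; ring.
by apply: filterS philt => x; rewrite /thin_solution; lra.
Qed.

Lemma thin_solution_signed_perm (R : realType) (U : set_system R) (s : 'I_5 -> R)
    p x :
  involutive p -> (forall i, s i = 1 \/ s i = -1) -> p ord_max = ord_max ->
  (forall i, s (p i) = s i) ->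
  thin_solution U (signed_perm s p x) = thin_solution U x.
Proof.
move=> pK s1 pm sp.
by rewrite /thin_solution harmonic_spiky_signed_perm // limit_sol_signed_perm.
Qed.

Lemma thin_solution_even (R : realType) (U : set_system R) x :
  thin_solution U (thin_reflection x) = thin_solution U x.
Proof.
pose s (i : 'I_5) : R := if i == ord_max then -1 else 1.
have -> : thin_reflection x = signed_perm s id x.
  by apply/rowP => i; rewrite !mxE /s; case: eqP => _; rewrite ?mulN1r ?mul1r.
apply: thin_solution_signed_perm => // i.
by rewrite /s; case: eqP; [right|left].
Qed.

Lemma thin_solution_obstacle (R : realType) (U : set_system R) :
  UltraFilter U -> 0^'+ `<=` U -> thin_obstacle_solution (thin_solution U).
Proof.
move=> UU hU; split.
- by move=> x; exact: thin_solution_continuous.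
- by move=> x; exact: thin_solution_ge0.
- exact: thin_solution_harmonic.
- exact: thin_solution_superharmonic.
- exact: thin_solution_even.
Qed.

(** * Growth and compactness *)

(** Positive dimension makes a degenerate box have volume 0; in dimension 0 the empty product is
    1. *)
Lemma lebesgue_null0 (R : realType) (n : nat) :
  lebesgue_null (set0 : set 'rV[R]_n.+1).
Proof.
move=> e e0; exists (fun=> 0), (fun=> 0); split; first by [].
rewrite eseries0 ?lee_fin ?ltW // => k _ _.
by rewrite /box_volume big_ord_recl subrr maxxx mul0r.
Qed.

Lemma polynomial_growth_of_le (R : realType) (n m : nat) (u : 'rV[R]_n.+1 -> R)
    (C : R) :
  (forall x, `|u x| <= C * (1 + euclid_norm x ^+ m)) -> polynomial_growth m u.
Proof.
move=> uC; apply: le_lt_trans (ltry C); apply: ereal_inf_lbound => /=.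
rewrite [X in lebesgue_null X](_ : _ = set0); first exact: lebesgue_null0.
apply/seteqP; split=> // x /=; apply; rewrite lee_fin.
have d0 : 0 < 1 + euclid_norm x ^+ m.
  by rewrite ltr_wpDr // exprn_ge0 // sqrtr_ge0.
by rewrite normrM normfV (gtr0_norm d0) ler_pdivrMr.
Qed.

Lemma thin_solution_growth (R : realType) (U : set_system R) :
  UltraFilter U -> polynomial_growth 4 (thin_solution U).
Proof.
move=> UU; apply: (@polynomial_growth_of_le _ _ _ _ 30) => x.
have -> : euclid_norm x ^+ 4 = sqnorm x ^+ 2.
  by rewrite /euclid_norm -[4%N]/(2 * 2)%N exprM sqr_sqrtr //; exact: sqnorm_ge0.
have w0 := limit_sol_ge0 x UU; have w1 := limit_sol_le1 x UU.
have q0 := thin_sum2_ge0 x; have qs := thin_sum2_le x.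
have r0 := thin_sum4_ge0 x; have rq := thin_sum4_le x.
have zs := le_sqnorm x ord_max; have z0 := sqr_ge0 (x 0 ord_max).
rewrite /thin_solution /harmonic_spiky /spiky.
have -> : x 0 ord_max ^+ 4 = (x 0 ord_max ^+ 2) ^+ 2 by rewrite -exprM.
have := flatE R; have := flat_gt0 R.
move: (flat R) (limit_sol U x) (thin_sum2 x) (thin_sum4 x) (x 0 ord_max ^+ 2)
  (sqnorm x) w0 w1 q0 qs r0 rq zs z0 => e w q r z s w0 w1 q0 qs r0 rq zs z0 e0 eE.
have e1 : e <= 1 by lra.
have q2 : q ^+ 2 <= s ^+ 2 by rewrite ler_pXn2r // nnegrE; lra.
have z2 : z ^+ 2 <= s ^+ 2 by rewrite ler_pXn2r // nnegrE; lra.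
have zq : z * q <= s ^+ 2 by rewrite expr2 ler_pM.
have zq0 : 0 <= z * q by rewrite mulr_ge0.
have z20 : 0 <= z ^+ 2 by exact: sqr_ge0.
have A : 0 <= (1 - e) * r <= s ^+ 2.
  by apply/andP; split; [rewrite mulr_ge0 //; lra | nra].
have B : 0 <= 6 * (1 + e) * (z * q) <= 12 * s ^+ 2.
  by apply/andP; split; [rewrite !mulr_ge0 //; lra | nra].
have C : 0 <= 4 * (1 + e) * z ^+ 2 <= 8 * s ^+ 2.
  by apply/andP; split; [rewrite !mulr_ge0 //; lra | nra].
have q20 : 0 <= q ^+ 2 by exact: sqr_ge0.
move: A B C => /andP[? ?] /andP[? ?] /andP[? ?].
by rewrite ler_norml; apply/andP; split; lra.
Qed.

Lemma contact_spiky_le1 (R : realType) (U : set_system R) (x : 'rV[R]_5) :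
  UltraFilter U -> contact_set (thin_solution U) x -> spiky x <= 1.
Proof.
by move=> UU /thin_solution_contact [_ E]; have := limit_sol_ge0 x UU; lra.
Qed.

Lemma thin_solution_contact_compact (R : realType) (U : set_system R) :
  UltraFilter U -> 0^'+ `<=` U -> compact (contact_set (thin_solution U)).
Proof.
move=> UU hU; apply: bounded_closed_compact; last first.
  by apply: contact_set_closed => x; exact: thin_solution_continuous.
exists 10; split; first exact: num_real.
move=> M M10 x Cx; apply: rV_norm_le => [|i]; first lra.
have [ti|] := boolP (thin_coord i).
  by have := spiky_bounded (contact_spiky_le1 UU Cx) ti; lra.
rewrite negbK => /eqP ->; have [-> _] := Cx; rewrite normr0; lra.
Qed.

Lemma limit_sol_infty (R : realType) (U : set_system R) :
  UltraFilter U -> 0^'+ `<=` U -> forall e : R, 0 < e ->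
  exists2 r, 0 < r & forall x, r <= `|x| -> limit_sol U x <= e.
Proof.
move=> UU hU e e0; have c0 : 0 < 516 :> R by lra.
have k0 := divr_gt0 c0 e0.
exists (516 / e + 1) => [|x xr]; first lra.
apply: le_trans (limit_sol_le_barrier x UU hU) _.
have q0 := sqnorm_ge0 x; have := sqr_norm_le_sqnorm x.
have kE : 516 = 516 / e * e by rewrite divfK // gt_eqF.
rewrite /barrier ler_pdivrMr; last lra.
move: (516 / e) k0 kE xr => k k0 kE xr qx.
have : k <= `|x| ^+ 2 by nra.
rewrite {1}kE; nra.
Qed.

(** * Minimality of the limit and star-shapedness *)

(** The form in which minimality of [w] is used after the limit: a competitor need only dominate it
    on the contact set, because elsewhere [w] is harmonic and at infinity it decays. *)
Lemma limit_sol_comparison (R : realType) (U : set_system R)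
    (w : 'rV[R]_5 -> R) :
  UltraFilter U -> 0^'+ `<=` U ->
  superharmonic_limit U w -> (forall x, 0 <= w x) ->
  (forall x, contact_set (thin_solution U) x -> limit_sol U x <= w x) ->
  forall x, limit_sol U x <= w x.
Proof.
move=> UU hU sw w0 ww.
apply: (harmonic_comparison UU (leqnn 5) (A := ~` contact_set (thin_solution U))) => //.
- by move=> x; exact: limit_sol_continuous.
- exact: noncontact_open.
- exact: limit_sol_harmonic.
- exact: limit_sol_infty.
- by move=> x /contrapT; exact: ww.
Qed.

Lemma contact0 (R : realType) (U : set_system R) :
  UltraFilter U -> contact_set (thin_solution U) 0.
Proof.
move=> UU; apply/thin_solution_contact; rewrite mxE; split=> //.
have := limit_sol_ge_wedge (0 : 'rV[R]_5) UU; have := limit_sol_le1 (0 : 'rV[R]_5) UU.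
by rewrite wedge_thin ?mxE // spiky0; lra.
Qed.

(* Zooming in by [t < 1] turns the obstacle [1 - spiky] into
   [t ^ -4 - spiky], a vertical translate of the original one. *)
Lemma thin_solution_star_shaped (R : realType) (U : set_system R) :
  UltraFilter U -> 0^'+ `<=` U -> star_shaped (contact_set (thin_solution U)).
Proof.
move=> UU hU; exists 0; first exact: contact0.
move=> x Cx t /andP[t0 t1]; rewrite scaler0 add0r.
have [->|tn0] := eqVneq t 0; first by rewrite scale0r; exact: contact0.
have {}t0 : 0 < t by rewrite lt_neqAle eq_sym tn0.
have t4 : 0 < t ^+ 4 by rewrite exprn_gt0.
have t41 : t ^+ 4 <= 1 by rewrite exprn_ile1 // ltW.
have [z0 wx] := (thin_solution_contact U x).1 Cx.
have z0' : (t *: x) 0 ord_max = 0 by rewrite mxE z0 mulr0.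
(* On the contact set [w y = 1 - P y], and homogeneity gives [t^4 w(y / t) >= t^4 - P y]. At [t x]
   the right side equals [t^4 (1 - P x) + 1 - t^4 = 1 - P (t x)], which is the obstacle. *)
have le y : limit_sol U y <= t ^+ 4 * limit_sol U (t^-1 *: y) + (1 - t ^+ 4).
  move: y; apply: limit_sol_comparison => //.
  - apply: superharmonic_limit_affine => //; first exact: ltW.
    exact: superharmonic_limit_sol.
  - move=> y; have := mulr_ge0 (ltW t4) (limit_sol_ge0 (t^-1 *: y) UU); lra.
  - move=> y /thin_solution_contact [y0 ->].
    have := limit_sol_ge_wedge (t^-1 *: y) UU.
    rewrite wedge_thin ?mxE ?y0 ?mulr0 // spikyZ => /(ler_wpM2l (ltW t4)).
    by rewrite mulrBr mulrA -exprMn divff // expr1n; lra.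
apply/thin_solution_contact; split=> //.
have := limit_sol_ge_wedge (t *: x) UU; rewrite wedge_thin //.
have := le (t *: x); rewrite scalerA mulVf // scale1r wx spikyZ; lra.
Qed.

(** * Nonconvexity *)

Lemma contact_signed_perm (R : realType) (U : set_system R) (s : 'I_5 -> R)
    p x :
  involutive p -> (forall i, s i = 1 \/ s i = -1) -> p ord_max = ord_max ->
  (forall i, s (p i) = s i) -> contact_set (thin_solution U) x ->
  contact_set (thin_solution U) (signed_perm s p x).
Proof.
move=> pK s1 pm sp [z0 ux]; split; first by rewrite mxE pm z0 mulr0.
by rewrite thin_solution_signed_perm.
Qed.

(* If the contact set were convex, then by symmetry it would contain
   [x_i / 2 (e_i + e_j)] along with [x], and hence be bounded independently of
   the size of [flat]. *)
Lemma convex_contact_bounded (R : realType) (U : set_system R) :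
  UltraFilter U -> convex_set (contact_set (thin_solution U)) ->
  forall x i, contact_set (thin_solution U) x -> `|x 0 i| <= 2.
Proof.
move=> UU cvx x i Cx.
have mid y z : contact_set (thin_solution U) y ->
    contact_set (thin_solution U) z ->
    contact_set (thin_solution U) (2^-1 *: y + 2^-1 *: z).
  move=> /mem_set Cy /mem_set Cz.
  have h0 : 0 <= 2^-1 :> R by lra.
  have h1 : 2^-1 <= 1 :> R by lra.
  have := set_mem (cvx y z (Itv01 h0 h1) Cy Cz); rewrite /conv /= /unstable.onem.
  by have -> : 1 - 2^-1 = 2^-1 :> R by field.
have [ti|] := boolP (thin_coord i); last first.
  by rewrite negbK => /eqP ->; have [-> _] := Cx; rewrite normr0.
(* The reflection flips every thin coordinate except [i], so the midpoint of [x] and its image is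
   [x_i e_i]. *)
pose s (k : 'I_5) : R := if (k == i) || (k == ord_max) then 1 else -1.
have s1 k : s k = 1 \/ s k = -1 by rewrite /s; case: ifP; [left|right].
have C1 : contact_set (thin_solution U) (x 0 i *: 'e_i).
  have -> : x 0 i *: 'e_i = 2^-1 *: x + 2^-1 *: signed_perm s id x.
    apply/rowP => k; rewrite !mxE /s.
    have [->|ki] := eqVneq k i; first by rewrite /=; field.
    have [->|km] /= := eqVneq k ord_max; last by field.
    by have [-> _] := Cx; field.
  by apply: mid => //; exact: contact_signed_perm.
have [j tj ji] : exists2 j : 'I_5, thin_coord j & j != i.
  by have [->|i0] := eqVneq i ord0; [exists (lift ord0 ord0)|exists ord0 => //; rewrite eq_sym].
have C2 : contact_set (thin_solution U) (x 0 i *: 'e_j).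
  have p1 : tperm i j ord_max = ord_max by rewrite tpermD.
  have -> : x 0 i *: 'e_j = signed_perm (fun=> 1) (tperm i j) (x 0 i *: 'e_i).
    apply/rowP => k; rewrite !mxE mul1r eqxx /=.
    by rewrite -[X in _ = _ * (_ == X)%:R](tpermR i j) (inj_eq perm_inj).
  by apply: contact_signed_perm => // [k|_]; [exact: tpermK|left].
have := contact_spiky_le1 UU (mid _ _ C1 C2).
set y := 2^-1 *: _ + _.
have yE : y = (0 + (x 0 i / 2) *: 'e_i) + (x 0 i / 2) *: 'e_j.
  by rewrite add0r /y !scalerA [2^-1 * _]mulrC.
have e0 (k : 'I_5) : (0 + (x 0 i / 2) *: 'e_i : 'rV[R]_5) 0 j = 0.
  by rewrite !mxE (negbTE ji) /=; ring.
rewrite /spiky yE !thin_sum2_step // !thin_sum4_step // e0 // thin_sum2_0 thin_sum4_0 mxE.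
have := flat_gt0 R; set a : R := x 0 i => fl.
have -> : ((0 + 2 * (a / 2) * 0 + (a / 2) ^+ 2 + 2 * (a / 2) * 0 + (a / 2) ^+ 2) ^+ 2 -
  (1 - flat R) * (0 + (0 + a / 2) ^+ 4 - 0 ^+ 4 + (0 + a / 2) ^+ 4 - 0 ^+ 4)) =
  (1 + flat R) * (a ^+ 2) ^+ 2 / 8 by field.
(* At this midpoint [P = (1 + flat) a^4 / 8], so [P <= 1] forces [a^4 <= 8 < 2^4]. *)
move=> a4; rewrite leNgt; apply/negP => a2.
have : 4 < a ^+ 2.
  rewrite -[a ^+ 2]real_normK ?num_real // expr2.
  have -> : 4 = 2 * 2 :> R by ring.
  by rewrite ltr_pM.
clear -a4 fl; move: (a ^+ 2) (flat R) a4 fl => b f a4 fl b4; nra.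
Qed.

(** [36 = 16 + 5 * 2^2] makes [36 * barrier] at least 1 on the box that convexity would impose. At
    distance 8 on an axis the barrier is [1 / 80], so [w <= 0.45], whereas the obstacle there is
    [1 - 0.4096]. *)
Lemma thin_solution_contact_nonconvex (R : realType) (U : set_system R) :
  UltraFilter U -> 0^'+ `<=` U -> ~ convex_set (contact_set (thin_solution U)).
Proof.
move=> UU hU cvx; have bd := convex_contact_bounded UU cvx.
pose x : 'rV[R]_5 := 8 *: 'e_ord0.
have le : limit_sol U x <= 36 * barrier x.
  have := @limit_sol_comparison R U
    (fun y => 36 * barrier (1^-1 *: y) + 0) UU hU _ _ _ x.
  rewrite invr1 scale1r addr0; apply.
  - have := superharmonic_limit_affine (a := 36) 0 UU _ ltr01
      (superharmonic_limit_barrier UU hU (leqnn 5)).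
    by rewrite invr1; apply; lra.
  - by move=> y; have := barrier_gt0 (1 *: y); lra.
  - move=> y Cy; rewrite scale1r addr0.
    apply: le_trans (limit_sol_le1 y UU) _.
    have q0 := sqnorm_ge0 y.
    have := @sqnorm_le_norm R 5 y 2 (fun i => bd y i Cy).
    by rewrite /barrier ler_pdivlMr; lra.
have x0 : x 0 ord_max = 0 by rewrite !mxE /= mulr0.
have t0 : thin_coord (ord0 : 'I_5) by [].
have s0 : sqnorm (0 : 'rV[R]_5) = 0.
  by rewrite /sqnorm big1 // => k _; rewrite mxE; ring.
have xs : spiky x = flat R * 8 ^+ 4.
  rewrite /spiky /x -[_ *: _]add0r thin_sum2_step // thin_sum4_step //.
  by rewrite thin_sum2_0 thin_sum4_0 !mxE; ring.
have xb : barrier x = 80^-1.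
  by rewrite /barrier /x -[_ *: _]add0r sqnorm_step s0 mxE; congr (_^-1); ring.
have := limit_sol_ge_wedge x UU; rewrite wedge_thin // xs.
have := flatE R; move: le; rewrite xb; lra.
Qed.

Theorem lemma1p2 (R : realType) :
  exists (n : nat) (u : 'rV[R]_n.+1 -> R),
    [/\ (2 <= n)%N,
        thin_obstacle_solution u,
        polynomial_growth 4 u &
        [/\ compact (contact_set u),
            ~ convex_set (contact_set u) &
            star_shaped (contact_set u)]].
Proof.
(* Any ultrafilter refining the right neighbourhoods of 0 will do; whether the limit depends on it
   is irrelevant. *)
have [U [UU hU]] := ultraFilterLemma (@at_right_proper_filter R 0).
exists 4%N, (thin_solution U); split=> //.
- exact: thin_solution_obstacle.
- exact: thin_solution_growth.
- split.
  + exact: thin_solution_contact_compact.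
  + exact: thin_solution_contact_nonconvex.
  + exact: thin_solution_star_shaped.
Qed.
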